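(* Let $\mathcal{A}$ and $\mathfrak{A}$ be Banach algebras such that $\mathcal{A}$ is a Banach $\mathfrak{A}$-bimodule with compatible actions. Assume that $\mathfrak{A}$ acts on $\mathcal{A}$ trivially from the left, that $\mathcal{A}/J$ has a left identity, and that $\mathfrak{A}$ has a bounded approximate identity for $\mathcal{A}$. If $\mathcal{A}$ is module biprojective (as an $\mathfrak{A}$-module), then the Banach algebra $\mathcal{A}/J$ is biprojective.
   Context: Compatible actions: $\alpha\cdot(ab)=(\alpha\cdot a)b$ and $(ab)\cdot\alpha=a(b\cdot\alpha)$ for $a,b\in\mathcal{A}$, $\alpha\in\mathfrak{A}$. $\mathfrak{A}$ acts trivially on $\mathcal{A}$ from the left if there is a continuous linear functional $f$ on $\mathfrak{A}$ with $\alpha\cdot a=f(\alpha)a$ for all $\alpha\in\mathfrak{A}$, $a\in\mathcal{A}$. $\mathfrak{A}$ has a bounded approximate identity for $\mathcal{A}$ if there is a bounded net $\{\alpha_j\}$ in $\mathfrak{A}$ such that $\|\alpha_j\cdot a-a\|\to 0$ and $\|a\cdot\alpha_j-a\|\to 0$ for each $a\in\mathcal{A}$. The projective tensor product $\mathcal{A}\widehat{\bigotimes}\mathcal{A}$ is a Banach algebra with $(a\otimes b)(c\otimes d)=ac\otimes bd$, and carries the canonical actions $a\cdot(b\otimes c)=ab\otimes c$, $(b\otimes c)\cdot a=b\otimes ca$, $\alpha\cdot(b\otimes c)=(\alpha\cdot b)\otimes c$, $(b\otimes c)\cdot\alpha=b\otimes(c\cdot\alpha)$. Let $I$ be the closed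 ideal of $\mathcal{A}\widehat{\bigotimes}\mathcal{A}$ generated by the elements $\alpha\cdot a\otimes b-a\otimes b\cdot\alpha$ ($\alpha\in\mathfrak{A}$, $a,b\in\mathcal{A}$). Let $\omega:\mathcal{A}\widehat{\bigotimes}\mathcal{A}\to\mathcal{A}$ be the bounded linear map with $\omega(a\otimes b)=ab$, and let $J$ be the closed ideal of $\mathcal{A}$ generated by $\omega(I)$ (that is, by the elements $\alpha\cdot(ab)-(ab)\cdot\alpha$). The quotients $(\mathcal{A}\widehat{\bigotimes}\mathcal{A})/I$ and $\mathcal{A}/J$ carry the induced actions of $\mathfrak{A}$ and $\mathcal{A}$. Let $\widetilde{\omega}:(\mathcal{A}\widehat{\bigotimes}\mathcal{A})/I\to\mathcal{A}/J$ be the induced map, $\widetilde{\omega}(a\otimes b+I)=ab+J$. An $\mathcal{A}/J$-$\mathfrak{A}$-module morphism $\varphi:X\to Y$ is a norm-continuous additive map (not assumed $\mathbb{C}$-linear) with $\varphi(\alpha\cdot x)=\alpha\cdot\varphi(x)$, $\varphi(x\cdot\alpha)=\varphi(x)\cdot\alpha$ for $\alpha\in\mathfrak{A}$, and commuting with the left and right actions of $\mathcal{A}/J$, where $a+J$ acts as $a\in\mathcal{A}$ does (i.e. $\varphi(a\cdot x)=a\cdot\varphi(x)$ and $\varphi(x\cdot a)=\varphi(x)\cdot a$ for $a\in\mathcal{A}$). $\mathcal{A}$ is module biprojective (as an $\mathfrak{A}$-module) if $\widetilde{\omega}$ has a bounded right inverse which is an $\mathcal{A}/J$-$\mathfrak{A}$-module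 morphism. A Banach algebra $\mathcal{B}$ is biprojective if the product map $\mathcal{B}\widehat{\bigotimes}\mathcal{B}\to\mathcal{B}$, $a\otimes b\mapsto ab$, has a bounded right inverse which is a $\mathcal{B}$-bimodule homomorphism. *)

(* Defs.v *)
From HB Require Import structures.
From mathcomp Require Import all_boot all_order all_algebra generic_quotient ring_quotient.
From mathcomp Require Import complex.
From mathcomp Require Import all_classical all_reals topology normedtype sequences.

Set Implicit Arguments.
Unset Strict Implicit.
Unset Printing Implicit Defensive.

Import Order.TTheory GRing.Theory Num.Theory.
Import numFieldNormedType.Exports.

Local Open Scope classical_set_scope.
Local Open Scope quotient_scope.
Local Open Scope complex_scope.
Local Open Scope ring_scope.

Section RealNorm.
Context {R : realType}.

(* The norm of a normed space over R[i] takes its values in R[i]; [nrm] is the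
   same norm with values in R (see [nrmE]), so that infima can be taken. *)
Definition nrm (V : normedModType R[i]) (x : V) : R := complex.Re `|x|.

Lemma Re_ge0 (z : R[i]) : 0 <= z -> 0 <= complex.Re z.
Proof. by rewrite lecE => /andP[]. Qed.

Lemma ReMr (z w : R[i]) : 0 <= z -> complex.Re (z * w) = complex.Re z * complex.Re w.
Proof.
move=> /ger0_Im; case: z => a b /= ->; case: w => c d /=.
by rewrite mul0r subr0.
Qed.

Lemma Re_norm0 : complex.Re `|0 : R[i]| = 0.
Proof. by rewrite normr0. Qed.

Variable V : normedModType R[i].

Lemma nrmE (x : V) : `|x| = (nrm x)%:C.
Proof. by rewrite RRe_real // ger0_real. Qed.

Lemma nrm_ge0 (x : V) : 0 <= nrm x.
Proof. exact: Re_ge0. Qed.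

Lemma nrmD (x y : V) : nrm (x + y) <= nrm x + nrm y.
Proof. by have := ler_normD x y; rewrite !nrmE -rmorphD lecR. Qed.

Lemma nrmZ (a : R[i]) (x : V) : nrm (a *: x) = complex.Re `|a| * nrm x.
Proof. by rewrite /nrm normrZ ReMr. Qed.

Lemma nrm0_eq0 (x : V) : nrm x = 0 -> x = 0.
Proof. by move=> h; apply: normr0_eq0; rewrite nrmE h. Qed.

Lemma nrm0 : nrm (0 : V) = 0.
Proof. by rewrite /nrm normr0. Qed.

Lemma nrmN (x : V) : nrm (- x) = nrm x.
Proof. by rewrite /nrm normrN. Qed.

Lemma nrmB (x y : V) : nrm (x - y) = nrm (y - x).
Proof. by rewrite /nrm distrC. Qed.

Lemma cvg_nrmP (u : nat -> V) (l : V) :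
  (u @ \oo --> l) <->
  (forall e : R, 0 < e -> exists N, forall n, (N <= n)%N -> nrm (u n - l) < e).
Proof.
split=> [/cvgrPdist_lt h e e0|h].
  have /h [N _ hN] : (0 : R[i]) < e%:C by rewrite ltcR.
  by exists N => n /hN /=; rewrite distrC nrmE ltcR.
apply/cvgrPdist_lt => e e0.
have eE : e = (complex.Re e)%:C by rewrite RRe_real // gtr0_real.
have [|N hN] := h (complex.Re e); first by rewrite -ltcR -eE.
by exists N => // n /= /hN; rewrite eE distrC nrmE ltcR.
Qed.

Lemma nrm_unique (u : nat -> V) (l l' : V) :
  (forall e : R, 0 < e -> exists N, forall n, (N <= n)%N -> nrm (u n - l) < e) ->
  (forall e : R, 0 < e -> exists N, forall n, (N <= n)%N -> nrm (u n - l') < e) ->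
  l = l'.
Proof.
move=> /cvg_nrmP h /cvg_nrmP h'; exact: (cvg_unique _ h h').
Qed.

End RealNorm.

Lemma half_lt (R : realType) (e : R) : 0 < e -> 0 < e / 2%:R.
Proof. by move=> e0; rewrite divr_gt0. Qed.

Lemma invn_small (R : realType) (e : R) : 0 < e -> exists N, forall n, (N <= n)%N -> n.+1%:R^-1 < e.
Proof.
move=> e0; exists (Num.bound e^-1) => n Nn.
rewrite -[ltRHS]invrK ltf_pV2 ?posrE ?invr_gt0 ?ltr0n //.
apply: (lt_trans (archi_boundP _)); first by rewrite invr_ge0 ltW.
by rewrite ltr_nat.
Qed.

Section CompleteSeq.
Context {R : realType} (V : completeNormedModType R[i]).
Lemma complete_seq (u : nat -> V) :
  (forall e : R, 0 < e -> exists N, forall m n, (N <= m)%N -> (N <= n)%N -> nrm (u m - u n) < e) ->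
  exists l, forall e : R, 0 < e -> exists N, forall n, (N <= n)%N -> nrm (u n - l) < e.
Proof.
move=> uC.
have : cvg (u @ \oo).
  apply: cauchy_cvg; apply: cauchy_exP => e e0.
  have eE : e = (complex.Re e)%:C by rewrite RRe_real // gtr0_real.
  have [|N hN] := uC (complex.Re e); first by rewrite -ltcR -eE.
  exists (u N); exists N => // n /= Nn; rewrite -ball_normE /= nrmE eE ltcR.
  exact: hN.
by move=> /cvg_ex [l /cvg_nrmP ?]; exists l.
Qed.
End CompleteSeq.

Section CompleteFilter.
Context {R : realType} (V : normedModType R[i]).
Hypothesis seqC : forall u : nat -> V,
  (forall e : R, 0 < e -> exists N, forall m n, (N <= m)%N -> (N <= n)%N -> nrm (u m - u n) < e) ->
  exists l, forall e : R, 0 < e -> exists N, forall n, (N <= n)%N -> nrm (u n - l) < e.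

Lemma complete_filter (F : set_system V) : ProperFilter F -> cauchy F -> cvg F.
Proof.
move=> FF /cauchyP FC; apply/cvg_ex.
have /choice [x xP] : forall n : nat, exists x : V, F [set y | nrm (x - y) < n.+1%:R^-1].
  move=> n; have [|x xF] := FC (n.+1%:R^-1 : R)%:C; first by rewrite ltcR invr_gt0.
  exists x; apply: filterS xF => y; rewrite -ball_normE /= nrmE ltcR; exact.
have close e : 0 < e -> exists N, forall m n, (N <= m)%N -> (N <= n)%N -> nrm (x m - x n) < e.
  move=> e0; have [N hN] := invn_small (half_lt e0).
  exists N => m n /hN hm /hN hn.
  have [y [/= y1 y2]] := filter_ex (filterI (xP m) (xP n)).
  rewrite -[x m](subrK y) -addrA; apply: le_lt_trans (nrmD _ _) _.
  rewrite (splitr e) ltrD //; first exact: lt_trans hm.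
  by rewrite nrmB; exact: lt_trans hn.
have [l hl] := seqC close.
exists l; apply/cvgrPdist_lt => e e0.
have eE : e = (complex.Re e)%:C by rewrite RRe_real // gtr0_real.
have e1 : 0 < complex.Re e by rewrite -ltcR -eE.
have [N hN] := hl _ (half_lt e1).
have [M hM] := invn_small (half_lt e1).
apply: filterS (xP (maxn N M)) => y /= hy; rewrite nrmE eE ltcR.
rewrite -[l](subrK (x (maxn N M))) -addrA; apply: le_lt_trans (nrmD _ _) _.
rewrite (splitr (complex.Re e)) ltrD //.
  by rewrite nrmB; apply: hN; rewrite leq_maxl.
by apply: (lt_trans hy); apply: hM; rewrite leq_maxr.
Qed.
End CompleteFilter.

Definition cauchy_for {R : realType} {V : lmodType R[i]} (p : V -> R) (u : nat -> V) :=
  forall e : R, 0 < e -> exists N, forall m n, (N <= m)%N -> (N <= n)%N -> p (u m - u n) < e.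

Definition cvg_for {R : realType} {V : lmodType R[i]} (p : V -> R) (u : nat -> V) (l : V) :=
  forall e : R, 0 < e -> exists N, forall n, (N <= n)%N -> p (u n - l) < e.

Record seminormed (R : realType) := Seminormed {
  sn_sort :> lmodType R[i];
  sn : sn_sort -> R;
  snD : forall x y, sn (x + y) <= sn x + sn y;
  snZ : forall (a : R[i]) x, sn (a *: x) = complex.Re `|a| * sn x
}.

Record complete_seminormed (R : realType) := CompleteSeminormed {
  csn :> seminormed R;
  csn_complete : forall u : nat -> csn,
    cauchy_for (@sn R csn) u -> exists l, cvg_for (@sn R csn) u l
}.

Section SeminormTheory.
Context {R : realType} (S : seminormed R).
Implicit Types x y z : S.

Lemma sn0 : sn (0 : S) = 0.
Proof. by rewrite -(scale0r (0 : S)) snZ Re_norm0 mul0r. Qed.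
Lemma snN x : sn (- x) = sn x.
Proof. by rewrite -scaleN1r snZ normrN1 mul1r. Qed.
Lemma sn_ge0 x : 0 <= sn x.
Proof.
have := snD x (- x); rewrite subrr sn0 snN -mulr2n -mulr_natl pmulr_rge0 //.
Qed.
Lemma snB x y : sn (x - y) = sn (y - x).
Proof. by rewrite -snN opprB. Qed.
Lemma snD0 x y : sn y = 0 -> sn (x + y) = sn x.
Proof.
move=> y0; apply/eqP; rewrite eq_le; apply/andP; split.
  by have := snD x y; rewrite y0 addr0.
by have := snD (x + y) (- y); rewrite addrK snN y0 addr0.
Qed.

Definition null : {pred S} := [pred x | sn x == 0].
Lemma null_closed : zmod_closed null.
Proof.
split=> [|x y]; rewrite ?inE ?sn0 // => /eqP x0 /eqP y0.
by rewrite snD0 ?x0 // snN.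
Qed.
HB.instance Definition _ := GRing.isZmodClosed.Build S null null_closed.
End SeminormTheory.

(* The Banach space S / {x | sn x = 0}.  It is used both for the quotient of a
   Banach space by a closed subspace (with the distance to the subspace as
   seminorm) and for completions (with the seminorm lim (sn (u n)) on the space
   of Cauchy sequences). *)
Definition sepq (R : realType) (S : complete_seminormed R) := Quotient.quot (@null R S).

Section Sepq.
Context {R : realType} (S : complete_seminormed R).
Local Notation Q := (sepq S).
HB.instance Definition _ := GRing.Zmodule.on Q.
HB.instance Definition _ := Quotient.on Q.

Definition spi (x : S) : Q := \pi_(Quotient.quot (@null R S)) x.

Lemma spi_eq x y : spi x = spi y <-> sn (x - y) = 0.
Proof.
rewrite /spi; split=> [h|h].
  by apply/eqP; have := Quotient.idealrBE (@null R S) x y; rewrite h eqxx inE.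
by apply/eqP; rewrite -Quotient.idealrBE inE h.
Qed.
Definition srepr (z : Q) : S := repr (z : Quotient.quot (@null R S)).
Lemma sreprK z : spi (srepr z) = z.
Proof. exact: reprK. Qed.
Lemma spiP z : exists x, z = spi x.
Proof. by exists (srepr z); rewrite sreprK. Qed.
Lemma spiD x y : spi (x + y) = spi x + spi y.
Proof. exact: (raddfD (\pi_(Quotient.quot (@null R S)))). Qed.
Lemma spi0 : spi 0 = 0.
Proof. exact: (raddf0 (\pi_(Quotient.quot (@null R S)))). Qed.
Lemma spiN x : spi (- x) = - spi x.
Proof. exact: (raddfN (\pi_(Quotient.quot (@null R S)))). Qed.
Lemma spiB x y : spi (x - y) = spi x - spi y.
Proof. by rewrite spiD spiN. Qed.
Lemma sn_srepr x : sn (srepr (spi x) - x) = 0.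
Proof. by apply/spi_eq; rewrite sreprK. Qed.
Lemma sn_srepr_pi x : sn (srepr (spi x)) = sn x.
Proof. by rewrite -(subrK x (srepr _)) addrC snD0 ?sn_srepr. Qed.

Definition sscale (a : R[i]) (z : Q) : Q := spi (a *: srepr z).
Lemma sscaleE a x : sscale a (spi x) = spi (a *: x).
Proof. by apply/spi_eq; rewrite -scalerBr snZ sn_srepr mulr0. Qed.
Fact sscaleA a b z : sscale a (sscale b z) = sscale (a * b) z.
Proof. by have [x ->] := spiP z; rewrite !sscaleE scalerA. Qed.
Fact sscale1 : left_id 1 sscale.
Proof. by move=> z; have [x ->] := spiP z; rewrite !sscaleE scale1r. Qed.
Fact sscaleDr : right_distributive sscale +%R.
Proof.
move=> a z z'; have [x ->] := spiP z; have [x' ->] := spiP z'.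
by rewrite -spiD !sscaleE scalerDr spiD.
Qed.
Fact sscaleDl z : {morph sscale^~ z : a b / a + b}.
Proof.
by move=> a b; have [x ->] := spiP z; rewrite !sscaleE scalerDl spiD.
Qed.
HB.instance Definition _ := GRing.Zmodule_isLmodule.Build R[i] Q sscaleA sscale1 sscaleDr sscaleDl.

Lemma spiZ a x : spi (a *: x) = a *: spi x.
Proof. by rewrite -sscaleE. Qed.

Definition snorm (z : Q) : R[i] := (sn (srepr z))%:C.
Lemma snormE x : snorm (spi x) = (sn x)%:C.
Proof. by rewrite /snorm sn_srepr_pi. Qed.
Fact snormD z z' : snorm (z + z') <= snorm z + snorm z'.
Proof.
have [x ->] := spiP z; have [x' ->] := spiP z'.
by rewrite -spiD !snormE -rmorphD lecR snD.
Qed.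
Fact snormZ a z : snorm (a *: z) = `|a| * snorm z.
Proof.
have [x ->] := spiP z; rewrite -spiZ !snormE snZ.
by rewrite -[X in _ = X * _]RRe_real ?ger0_real // -rmorphM.
Qed.
Fact snorm0_eq0 z : snorm z = 0 -> z = 0.
Proof.
have [x ->] := spiP z; rewrite snormE => /complexI h.
by rewrite -spi0; apply/spi_eq; rewrite subr0.
Qed.
HB.instance Definition _ := Lmodule_isNormed.Build R[i] Q snormD snormZ snorm0_eq0.

Lemma nrm_spi (x : S) : nrm (spi x) = sn x.
Proof. by rewrite /nrm [`|_|]snormE. Qed.

Fact sepq_complete (F : set_system Q) : ProperFilter F -> cauchy F -> cvg F.
Proof.
apply: complete_filter => u uC.
have [] := @csn_complete R S (fun n => srepr (u n)).
  move=> e /uC [N hN]; exists N => m n mN nN.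
  by rewrite -nrm_spi spiB !sreprK; apply: hN.
move=> l hl; exists (spi l) => e /hl [N hN]; exists N => n nN.
by rewrite -(sreprK (u n)) -spiB nrm_spi; apply: hN.
Qed.
HB.instance Definition _ := Uniform_isComplete.Build Q sepq_complete.
End Sepq.

Section Completion.
Context {R : realType} (S : seminormed R).

Definition is_cauchy : {pred (nat -> S)} := [pred u | `[< cauchy_for (@sn R S) u >]].

Lemma is_cauchyP u : reflect (cauchy_for (@sn R S) u) (u \in is_cauchy).
Proof. exact: asboolP. Qed.

Lemma is_cauchy_submod : submod_closed is_cauchy.
Proof.
split=> [|a u v].
  by apply/is_cauchyP; move=> e e0; exists 0%N => m n _ _; rewrite subrr sn0.
move=> /is_cauchyP uC /is_cauchyP vC; apply/is_cauchyP => e e0.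
pose c := complex.Re `|a| + 1.
have c0 : 0 < c by rewrite ltr_wpDl // Re_ge0.
have [N hN] := uC (e / 2%:R / c) (divr_gt0 (half_lt e0) c0).
have [M hM] := vC (e / 2%:R) (half_lt e0).
exists (maxn N M) => m n; rewrite !geq_max => /andP[Nm Mm] /andP[Nn Mn].
have -> : (a *: u + v) m - (a *: u + v) n = a *: (u m - u n) + (v m - v n).
  by rewrite scalerBr opprD addrACA.
apply: le_lt_trans (snD _ _) _; rewrite (splitr e) ler_ltD ?hM // snZ.
apply: (@le_trans _ _ (c * sn (u m - u n))).
  by rewrite ler_wpM2r ?sn_ge0 // lerDl.
by rewrite mulrC -ler_pdivlMr // ltW // hN.
Qed.
HB.instance Definition _ := GRing.isSubmodClosed.Build R[i] (nat -> S) is_cauchy is_cauchy_submod.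

Record cseq := CSeq { cs :> nat -> S; _ : cs \in is_cauchy }.
HB.instance Definition _ := [isSub for cs].
HB.instance Definition _ := [Choice of cseq by <:].
HB.instance Definition _ := [SubChoice_isSubLmodule of cseq by <:].

Lemma cseqP (u : cseq) : cauchy_for (@sn R S) u.
Proof. by case: u => u /= /is_cauchyP. Qed.

Lemma cs_eq (u v : cseq) : (forall n, cs u n = cs v n) -> u = v.
Proof. by move=> h; apply: val_inj; apply/funext. Qed.
Lemma csD (u v : cseq) n : cs (u + v) n = cs u n + cs v n. Proof. by []. Qed.
Lemma csN (u : cseq) n : cs (- u) n = - cs u n. Proof. by []. Qed.
Lemma csZ a (u : cseq) n : cs (a *: u) n = a *: cs u n. Proof. by []. Qed.

Definition cseq_sn (u : cseq) : R := limn (fun n => sn (cs u n)).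

Lemma sn_dist (x y : S) : `|sn x - sn y| <= sn (x - y).
Proof.
rewrite ler_norml; apply/andP; split.
  by rewrite lerNl opprB lerBlDr snB; have := snD (y - x) x; rewrite subrK.
by rewrite lerBlDr; have := snD (x - y) y; rewrite subrK.
Qed.

Lemma cseq_sn_cvg (u : cseq) : (fun n => sn (cs u n)) @ \oo --> cseq_sn u.
Proof.
suff : cvgn (fun n => sn (cs u n)) by [].
apply: cauchy_cvg; apply: cauchy_exP => e e0.
have [N hN] := cseqP u e0.
exists (sn (cs u N)); exists N => // n /= Nn; rewrite -ball_normE /=.
apply: le_lt_trans (sn_dist _ _) _; exact: hN.
Qed.
Arguments cseq_sn_cvg : clear implicits.

Lemma cseq_sn_le (u : cseq) c N : (forall n, (N <= n)%N -> sn (cs u n) <= c) -> cseq_sn u <= c.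
Proof.
move=> h; apply: (@closed_cvg _ _ \oo _ (fun n => sn (cs u n)) [set x | x <= c]).
- exact: closed_le.
- by exists N.
- exact: cseq_sn_cvg.
Qed.

Fact cseq_snD u v : cseq_sn (u + v) <= cseq_sn u + cseq_sn v.
Proof.
have h1 := cseq_sn_cvg (u + v).
have h2 : (fun n => sn (cs u n) + sn (cs v n)) @ \oo --> cseq_sn u + cseq_sn v.
  by apply: cvgD; exact: cseq_sn_cvg.
rewrite -(cvg_lim _ h1) // -(cvg_lim _ h2) //.
apply: ler_lim; [by apply/cvg_ex; eexists; exact: h1| by apply/cvg_ex; eexists; exact: h2|].
by apply: nearW => n; exact: snD.
Qed.

Fact cseq_snZ (a : R[i]) u : cseq_sn (a *: u) = complex.Re `|a| * cseq_sn u.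
Proof.
apply: (cvg_lim _) => //.
rewrite (_ : (fun n => _) = (fun n => complex.Re `|a| * sn (cs u n))).
  by apply: cvgMr; exact: cseq_sn_cvg.
by apply/funext => n; rewrite csZ snZ.
Qed.

Definition cseq_seminormed := Seminormed cseq_snD cseq_snZ.

Fact const_is_cauchy (x : S) : (fun _ : nat => x) \in is_cauchy.
Proof. by apply/is_cauchyP => e e0; exists 0%N => m n _ _; rewrite subrr sn0. Qed.
Definition cconst (x : S) : cseq := CSeq (const_is_cauchy x).

Lemma cseq_sn_const x : cseq_sn (cconst x) = sn x.
Proof. by rewrite /cseq_sn /=; apply: lim_cst. Qed.
Lemma cconstB x y : cconst (x - y) = cconst x - cconst y.
Proof. exact: cs_eq. Qed.

Lemma cseq_dense (u : cseq) (e : R) : 0 < e -> exists N, forall n, (N <= n)%N ->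
  cseq_sn (u - cconst (cs u n)) <= e.
Proof.
move=> /cseqP-/(_ u) [N hN]; exists N => n Nn; apply: (@cseq_sn_le _ _ N) => m Nm.
by rewrite csD csN ltW // hN.
Qed.

Fact cseq_complete (U : nat -> cseq_seminormed) :
  cauchy_for (@sn R cseq_seminormed) U -> exists l, cvg_for (@sn R cseq_seminormed) U l.
Proof.
move=> UC.
have /choice [w hw] : forall k, exists x : S, cseq_sn ((U k : cseq) - cconst x) <= k.+1%:R^-1.
  move=> k; have [|N /(_ N (leqnn N)) h] := @cseq_dense (U k) k.+1%:R^-1.
    by rewrite invr_gt0.
  by eexists; exact: h.
have wC : cauchy_for (@sn R S) w.
  move=> e e0; have e3 : 0 < e / 2%:R / 2%:R by rewrite !half_lt.
  have [N hN] := invn_small e3; have [M hM] := UC _ (half_lt e0).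
  exists (maxn N M) => m n; rewrite !geq_max => /andP[Nm Mm] /andP[Nn Mn].
  rewrite -cseq_sn_const cconstB.
  have -> : cconst (w m) - cconst (w n) = ((U m : cseq) - U n) + (((U n : cseq) - cconst (w n)) - ((U m : cseq) - cconst (w m))).
    by rewrite opprB [in RHS]addrA subrKA [in RHS]addrC subrKA.
  apply: le_lt_trans (cseq_snD _ _) _.
  rewrite (splitr e) ltr_leD ?hM //.
  apply: le_trans (cseq_snD _ _) _.
  rewrite (splitr (e / 2%:R)) lerD //.
    by apply: le_trans (hw _) _; exact: (ltW (hN _ _)).
  rewrite [cseq_sn _](@snN R cseq_seminormed); by apply: le_trans (hw _) _; exact: (ltW (hN _ _)).
have wi : w \in is_cauchy; first by apply/is_cauchyP.
exists (CSeq wi) => e e0.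
have [N hN] := invn_small (half_lt e0).
have e3 : 0 < e / 2%:R / 2%:R by rewrite !half_lt.
have [M hM] := @cseq_dense (CSeq wi) _ e3.
exists (maxn N M) => n; rewrite !geq_max => /andP[Nn Mn].
have -> : (U n : cseq_seminormed) - CSeq wi = ((U n : cseq) - cconst (w n)) - (CSeq wi - cconst (w n)).
  by rewrite opprB addrA subrK.
apply: le_lt_trans (snD _ _) _; rewrite snN (splitr e) ltr_leD //.
  by apply: le_lt_trans (hw _) _; exact: hN.
apply: le_trans (hM _ Mn) _.
by rewrite ler_pdivrMr // mulr_natr mulr2n lerDl ltW // half_lt.
Qed.

Definition completion := CompleteSeminormed cseq_complete.
End Completion.

(* The quotient seminorm x |-> inf_(j in J) |x + j|; its null space is J when J
   is closed ([dist_J], [dist0_J]). *)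
Section DistSeminorm.
Context {R : realType} (X : completeNormedModType R[i]) (J : set X).
Hypothesis J0 : J 0.
Hypothesis JL : forall (a : R[i]) x y, J x -> J y -> J (a *: x + y).

Definition dist (x : X) : R := inf [set nrm (x + j) | j in J].

Lemma dist_has_lb x : has_lbound [set nrm (x + j) | j in J].
Proof. by exists 0 => _ [j _ <-]; exact: nrm_ge0. Qed.
Lemma dist_neq0 x : [set nrm (x + j) | j in J] !=set0.
Proof. by exists (nrm (x + 0)); exists 0. Qed.
Lemma dist_le x j : J j -> dist x <= nrm (x + j).
Proof. by move=> Jj; apply: ge_inf; [exact: dist_has_lb|exists j]. Qed.
Lemma dist_lt x e : 0 < e -> exists2 j, J j & nrm (x + j) < dist x + e.
Proof.
move=> e0; have [_ [j Jj <-] h] := inf_adherent e0 (conj (dist_neq0 x) (dist_has_lb x)).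
by exists j.
Qed.
Lemma dist_le_nrm x : dist x <= nrm x.
Proof. by have := dist_le x J0; rewrite addr0. Qed.
Let JD x y : J x -> J y -> J (x + y).
Proof. by move=> ? ?; rewrite -[x]scale1r; exact: JL. Qed.
Let JZ a x : J x -> J (a *: x).
Proof. by move=> ?; rewrite -[_ *: _]addr0; exact: JL. Qed.
Let JN x : J x -> J (- x).
Proof. by rewrite -scaleN1r; exact: JZ. Qed.

Fact distD x y : dist (x + y) <= dist x + dist y.
Proof.
apply/ler_addgt0Pr => e e0.
have [j Jj hj] := dist_lt x (half_lt e0).
have [k Jk hk] := dist_lt y (half_lt e0).
apply: le_trans (dist_le _ (JD Jj Jk)) _.
rewrite addrACA; apply: le_trans (nrmD _ _) _.
by rewrite (splitr e) addrACA ltW // ltrD.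
Qed.

Let distZ_le (a : R[i]) x : dist (a *: x) <= complex.Re `|a| * dist x.
Proof.
have [->|a0] := eqVneq a 0.
  by rewrite normr0 mul0r scale0r -(@nrm0 _ X); exact: dist_le_nrm.
have c0 : 0 < complex.Re `|a|.
  by have := a0; rewrite -normr_gt0 ltcE => /andP[].
rewrite mulrC -ler_pdivrMr //; apply: lb_le_inf; first exact: dist_neq0.
move=> _ [j Jj <-]; rewrite ler_pdivrMr // mulrC -nrmZ scalerDr.
by apply: dist_le; exact: JZ.
Qed.

Fact distZ (a : R[i]) x : dist (a *: x) = complex.Re `|a| * dist x.
Proof.
apply/eqP; rewrite eq_le distZ_le andTb.
have [->|a0] := eqVneq a 0.
  by rewrite normr0 mul0r lb_le_inf //; [exact: dist_neq0|move=> _ [j _ <-]; exact: nrm_ge0].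
have := distZ_le a^-1 (a *: x); rewrite scalerA mulVf // scale1r => h.
apply: le_trans (ler_wpM2l _ h) _; first exact: Re_ge0.
by rewrite mulrA -ReMr // -normrM mulfV // normr1 mul1r.
Qed.

Definition dist_seminormed := Seminormed distD distZ.

Lemma dist_J x : J x -> dist x = 0.
Proof.
move=> /JN Jx; apply/eqP; rewrite eq_le (@sn_ge0 _ dist_seminormed) andbT.
by have := dist_le x Jx; rewrite subrr nrm0.
Qed.

Lemma dist0_J x : closed J -> dist x = 0 -> J x.
Proof.
move=> cJ d0; have /choice [j hj] : forall n : nat, exists j, J j /\ nrm (x + j) < n.+1%:R^-1.
  move=> n.
  have [|j Jj] := @dist_lt x n.+1%:R^-1; first by rewrite invr_gt0.
  by rewrite d0 add0r; exists j.
apply: (@closed_cvg _ _ \oo _ (fun n => - j n) J) => //.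
  by apply: nearW => n; apply: JN; case: (hj n).
apply/cvg_nrmP => e /invn_small [N hN]; exists N => n /hN; apply: lt_trans.
by rewrite -nrmN opprB opprK; case: (hj n).
Qed.

Fact dist_complete (u : nat -> dist_seminormed) :
  cauchy_for (@sn R dist_seminormed) u -> exists l, cvg_for (@sn R dist_seminormed) u l.
Proof.
move=> uC; pose h k : R := 2%:R^-1 ^+ k.
have h0 k : 0 < h k by rewrite exprn_gt0 // invr_gt0.
have /choice [N hN] : forall k, exists N, forall m n, (N <= m)%N -> (N <= n)%N -> dist (u m - u n) < h k.
  by move=> k; exact: uC.
pose M k := (\sum_(i < k.+1) N i)%N.
have NM k : (N k <= M k)%N by rewrite /M big_ord_recr /= leq_addl.
have MS k : (M k <= M k.+1)%N by rewrite {2}/M big_ord_recr /= leq_addr.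
have /choice [w hw] : forall k, exists w : X, nrm w < h k /\ J (w - (u (M k.+1) - u (M k))).
  move=> k; have lt1 : dist (u (M k.+1) - u (M k)) < h k.
    by apply: hN => //; apply: leq_trans (MS k); exact: NM.
  have [j Jj] := @dist_lt (u (M k.+1) - u (M k)) (h k - dist (u (M k.+1) - u (M k))) ltac:(by rewrite subr_gt0).
  rewrite [X in _ < X]addrC subrK => hj; exists (u (M k.+1) - u (M k) + j); split=> //.
  by rewrite addrC addKr.
pose s K : X := \sum_(k < K) w k.
have hS k : 2%:R * h k.+1 = h k by rewrite /h exprS mulrA mulfV ?mul1r // pnatr_eq0.
have s_diff K n : nrm (s (K + n)%N - s K) <= 2%:R * h K - 2%:R * h (K + n)%N.
  elim: n => [|n IH]; first by rewrite addn0 !subrr nrm0.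
  rewrite addnS /s big_ord_recr /= -/(s _) addrAC.
  apply: le_trans (nrmD _ _) _.
  have [/ltW hwn _] := hw (K + n)%N.
  apply: le_trans (lerD IH hwn) _.
  by rewrite hS -addrA lerD2l [X in - X]mulr_natl mulr2n opprD -addrA addNr addr0.
have s_le K n : nrm (s (K + n)%N - s K) <= 2%:R * h K.
  by apply: le_trans (s_diff _ _) _; rewrite lerBlDr lerDl mulr_ge0 // ltW.
have hsmall e : 0 < e -> exists K, 2%:R * h K < e.
  move=> e0; have [K hK] := invn_small (half_lt e0); exists K.
  rewrite mulrC -ltr_pdivlMr //; apply: le_lt_trans (hK _ (leqnn K)).
  rewrite /h exprVn lef_pV2 ?posrE ?exprn_gt0 ?ltr0n // -natrX ler_nat.
  by rewrite ltn_expl.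
have [sl hsl] := @complete_seq R X s ltac:(move=> e e0; have [K hK] := hsmall _ (half_lt e0);
  exists K => m n Km Kn; rewrite -(subnKC Km) -(subnKC Kn);
  rewrite -(subrK (s K) (s (K + (m - K))%N)) -addrA;
  apply: le_lt_trans (nrmD _ _) _; rewrite (splitr e) [X in _ + X]nrmB;
  apply: ltrD; apply: le_lt_trans (s_le _ _) _ => //).
have key K : J (s K - (u (M K) - u (M 0%N))).
  elim: K => [|K IH]; first by rewrite /s big_ord0 !subrr.
  have [_ Jw] := hw K.
  have := JD IH Jw.
  rewrite addrACA -opprD [X in _ - X]addrC addrA subrK.
  by rewrite /s [in X in _ -> X]big_ord_recr.
exists (u (M 0%N) + sl) => e e0.
have [K1 hK1] := hsmall _ (half_lt (half_lt e0)).
have [K2 hK2] := hsl _ (half_lt e0).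
pose K := maxn K1 K2.
have hK : h K < e / 2%:R.
  apply: lt_trans (_ : e / 2%:R / 2%:R < _); last first.
    by rewrite ltr_pdivrMr // mulr_natr mulr2n ltrDl half_lt.
  apply: le_lt_trans hK1; apply: (@le_trans _ _ (h K1)).
    rewrite /h; apply: ler_wiXn2l; [by rewrite invr_ge0|by rewrite invf_le1 // ler1n|exact: leq_maxl].
  by rewrite mulr_natl mulr2n lerDl ltW.
exists (M K) => n Mn.
rewrite -[u n](subrK (u (M K))) -addrA.
apply: le_lt_trans (distD _ _) _; rewrite (splitr e) ltrD //.
  apply: lt_trans hK; apply: hN => //; exact: leq_trans Mn.
have /JN Jk := key K.
have -> : u (M K) - (u (M 0%N) + sl) = (s K - sl) + (u (M K) - u (M 0%N) - s K).
  by rewrite [in RHS]addrC subrKA opprD addrA.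
rewrite -[u (M K) - u (M 0%N) - s K]opprB.
rewrite [dist _](@snD0 _ dist_seminormed); last exact: dist_J.
by apply: le_lt_trans (dist_le_nrm _) _; apply: hK2; exact: leq_maxr.
Qed.

Definition dist_complete_seminormed := CompleteSeminormed dist_complete.
End DistSeminorm.

Section AlgebraicTensor.
Context {R : realType} (X Y : normedModType R[i]).
Local Notation fsum := (seq (X * Y)).

(* A finite sequence of pairs (x_i, y_i) stands for the sum of the x_i (x) y_i.
   [teq] is equality in the algebraic tensor product, by generators and
   relations. *)
Inductive teq : fsum -> fsum -> Prop :=
| teq_refl s : teq s s
| teq_sym s t : teq s t -> teq t s
| teq_trans s t r : teq s t -> teq t r -> teq s r
| teq_cat s s' t t' : teq s s' -> teq t t' -> teq (s ++ t) (s' ++ t')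
| teq_comm s t : teq (s ++ t) (t ++ s)
| teq_addl x x' y : teq [:: (x + x', y)] [:: (x, y); (x', y)]
| teq_addr x y y' : teq [:: (x, y + y')] [:: (x, y); (x, y')]
| teq_scale (a : R[i]) x y : teq [:: (a *: x, y)] [:: (x, a *: y)]
| teq_zero y : teq [:: (0, y)] [::].

Definition teqb (s t : fsum) : bool := `[< teq s t >].
Lemma teqbP s t : reflect (teq s t) (teqb s t).
Proof. exact: asboolP. Qed.

Lemma teqb_equiv : equiv_class_of teqb.
Proof.
split=> [s|s t|t s r].
- by apply/teqbP; exact: teq_refl.
- by apply/teqbP/teqbP; exact: teq_sym.
- by move=> /teqbP h /teqbP h'; apply/teqbP; exact: teq_trans h'.
Qed.
Canonical teqb_equivrel := EquivRelPack teqb_equiv.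
Canonical teqb_encModRel := defaultEncModRel teqb.

Definition atens := {eq_quot teqb}.
HB.instance Definition _ := Choice.on atens.
HB.instance Definition _ := EqQuotient.on atens.

Definition api (s : fsum) : atens := \pi_atens s.
Definition arepr (z : atens) : fsum := repr z.

Lemma api_eq s t : api s = api t <-> teq s t.
Proof.
split=> [/eqP|h]; rewrite /api; first by rewrite piE => /teqbP.
by apply/eqP; rewrite piE; apply/teqbP.
Qed.
Lemma areprK z : api (arepr z) = z.
Proof. exact: reprK. Qed.
Lemma apiP z : exists s, z = api s.
Proof. by exists (arepr z); rewrite areprK. Qed.
Lemma teq_repr s : teq (arepr (api s)) s.
Proof. by apply/api_eq; rewrite areprK. Qed.

Definition fscale (a : R[i]) (s : fsum) : fsum := [seq (a *: p.1, p.2) | p <- s].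
Lemma teq_fscale a s t : teq s t -> teq (fscale a s) (fscale a t).
Proof.
elim=> {s t} //=.
- by move=> s; exact: teq_refl.
- by move=> s t _; exact: teq_sym.
- by move=> s t r _ h _; exact: teq_trans.
- by move=> s s' t t' _ h _ h'; rewrite /fscale !map_cat; exact: teq_cat.
- by move=> s t; rewrite /fscale !map_cat; exact: teq_comm.
- by move=> x x' y; rewrite scalerDr; exact: teq_addl.
- by move=> x y y'; exact: teq_addr.
- by move=> b x y; rewrite scalerA mulrC -scalerA; exact: teq_scale.
- by move=> y; rewrite scaler0; exact: teq_zero.
Qed.

Definition aadd (z w : atens) : atens := api (arepr z ++ arepr w).
Definition ascale (a : R[i]) (z : atens) : atens := api (fscale a (arepr z)).
Definition aopp (z : atens) : atens := ascale (- 1) z.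
Definition azero : atens := api [::].

Lemma aaddE s t : aadd (api s) (api t) = api (s ++ t).
Proof. by apply/api_eq; apply: teq_cat; exact: teq_repr. Qed.
Lemma ascaleE a s : ascale a (api s) = api (fscale a s).
Proof. by apply/api_eq; apply: teq_fscale; exact: teq_repr. Qed.

Lemma teq_perm s t : perm_eq s t -> teq s t.
Proof.
elim: s t => [|p s IH] t; first by rewrite perm_sym => /perm_nilP ->; exact: teq_refl.
move=> pt; have pin : p \in t by rewrite -(perm_mem pt) mem_head.
have [t1 [t2 et]] : exists t1 t2, t = t1 ++ p :: t2.
  by case/splitPr: pin => t1 t2; exists t1, t2.
subst t.
have st : perm_eq s (t1 ++ t2).
  by rewrite -(perm_cons p) (perm_trans pt) // perm_catC /= perm_cons perm_catC.
apply: (teq_trans (t := [:: p] ++ (t1 ++ t2))).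
  by rewrite -cat1s; apply: teq_cat; [exact: teq_refl|exact: IH].
rewrite -[p :: t2]cat1s !catA; apply: teq_cat; [exact: teq_comm|exact: teq_refl].
Qed.

Lemma teq_scaleD a b s : teq (fscale (a + b) s) (fscale a s ++ fscale b s).
Proof.
elim: s => [|[x y] s IH] /=; first exact: teq_refl.
apply: (teq_trans (t := [:: (a *: x, y); (b *: x, y)] ++ (fscale a s ++ fscale b s))).
  by rewrite -cat1s scalerDl; apply: teq_cat => //; exact: teq_addl.
apply: teq_perm => /=; rewrite perm_cons.
by rewrite -[X in perm_eq _ X]/(fscale a s ++ [:: (b *: x, y)] ++ fscale b s) perm_sym perm_catCA.
Qed.

Lemma teq_scale0 s : teq (fscale 0 s) [::].
Proof.
elim: s => [|[x y] s IH] /=; first exact: teq_refl.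
rewrite scale0r -cat1s -[X in teq _ X]cats0; apply: teq_cat => //; exact: teq_zero.
Qed.

Fact aaddA : associative aadd.
Proof.
move=> z w v; have [s ->] := apiP z; have [t ->] := apiP w; have [r ->] := apiP v.
by rewrite !aaddE catA.
Qed.
Fact aaddC : commutative aadd.
Proof.
move=> z w; have [s ->] := apiP z; have [t ->] := apiP w.
by rewrite !aaddE; apply/api_eq; exact: teq_comm.
Qed.
Fact aadd0 : left_id azero aadd.
Proof. by move=> z; have [s ->] := apiP z; rewrite aaddE. Qed.
Fact aaddN : left_inverse azero aopp aadd.
Proof.
move=> z; have [s ->] := apiP z; rewrite /aopp ascaleE aaddE; apply/api_eq.
have s1 : fscale 1 s = s.
  by rewrite /fscale -[RHS]map_id; apply: eq_map => -[x y]; rewrite scale1r.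
rewrite -[X in _ ++ X]s1; apply: teq_trans (teq_scale0 s).
by rewrite -(addNr (1 : R[i])); apply: teq_sym; exact: teq_scaleD.
Qed.
HB.instance Definition _ := GRing.isZmodule.Build atens aaddA aaddC aadd0 aaddN.

Fact ascaleA a b z : ascale a (ascale b z) = ascale (a * b) z.
Proof.
have [s ->] := apiP z; rewrite !ascaleE /fscale -map_comp.
by congr api; apply: eq_map => -[x y] /=; rewrite scalerA.
Qed.
Fact ascale1 : left_id 1 ascale.
Proof.
move=> z; have [s ->] := apiP z; rewrite ascaleE /fscale.
by congr api; rewrite -[RHS]map_id; apply: eq_map => -[x y] /=; rewrite scale1r.
Qed.
Fact ascaleDr : right_distributive ascale +%R.
Proof.
move=> a z w; have [s ->] := apiP z; have [t ->] := apiP w.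
by rewrite [X in ascale _ X]aaddE !ascaleE [RHS]aaddE /fscale map_cat.
Qed.
Fact ascaleDl z : {morph ascale^~ z : a b / a + b}.
Proof.
move=> a b; have [s ->] := apiP z; rewrite !ascaleE [RHS]aaddE.
by apply/api_eq; exact: teq_scaleD.
Qed.
HB.instance Definition _ := GRing.Zmodule_isLmodule.Build R[i] atens ascaleA ascale1 ascaleDr ascaleDl.

Lemma apiD s t : api (s ++ t) = api s + api t.
Proof. by rewrite -aaddE. Qed.
Lemma apiZ a s : api (fscale a s) = a *: api s.
Proof. by rewrite -ascaleE. Qed.
Lemma api_nil : api [::] = 0. Proof. by []. Qed.
Lemma api_sum s : api s = \sum_(p <- s) api [:: p].
Proof.
elim: s => [|p s IH]; first by rewrite big_nil.
by rewrite big_cons -cat1s apiD IH.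
Qed.

(* The projective norm: the infimum of the sums of the |x_i| |y_i| over all the
   representations of z as a sum of elementary tensors x_i (x) y_i. *)
Definition fnorm (s : fsum) : R := \sum_(p <- s) nrm p.1 * nrm p.2.
Definition pnorm (z : atens) : R := inf [set fnorm s | s in [set s | api s = z]].

Lemma fnorm_ge0 s : 0 <= fnorm s.
Proof. by apply: sumr_ge0 => p _; rewrite mulr_ge0 ?nrm_ge0. Qed.
Lemma pnorm_has_lb z : has_lbound [set fnorm s | s in [set s | api s = z]].
Proof. by exists 0 => _ [s _ <-]; exact: fnorm_ge0. Qed.
Lemma pnorm_neq0 z : [set fnorm s | s in [set s | api s = z]] !=set0.
Proof. by have [s ->] := apiP z; exists (fnorm s); exists s. Qed.
Lemma pnorm_le s : pnorm (api s) <= fnorm s.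
Proof. by apply: ge_inf; [exact: pnorm_has_lb|exists s]. Qed.
Lemma pnorm_lt z e : 0 < e -> exists2 s, api s = z & fnorm s < pnorm z + e.
Proof.
move=> e0; have [_ [s sz <-] h] := inf_adherent e0 (conj (pnorm_neq0 z) (pnorm_has_lb z)).
by exists s.
Qed.
Lemma fnormZ a s : fnorm (fscale a s) = complex.Re `|a| * fnorm s.
Proof.
rewrite /fnorm /fscale big_map mulr_sumr; apply: eq_bigr => -[x y] _ /=.
by rewrite nrmZ mulrA.
Qed.

Fact pnormD z w : pnorm (z + w) <= pnorm z + pnorm w.
Proof.
apply/ler_addgt0Pr => e e0.
have [s <- hs] := pnorm_lt z (half_lt e0).
have [t <- ht] := pnorm_lt w (half_lt e0).
rewrite -apiD; apply: le_trans (pnorm_le _) _.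
by rewrite /fnorm big_cat /= (splitr e) addrACA ltW // ltrD.
Qed.

Let pnorm0 : pnorm 0 <= 0.
Proof. by apply: le_trans (pnorm_le [::]) _; rewrite /fnorm big_nil. Qed.

Let pnorm_ge0 z : 0 <= pnorm z.
Proof. by apply: lb_le_inf; [exact: pnorm_neq0|move=> _ [s _ <-]; exact: fnorm_ge0]. Qed.

Let pnormZ_le a z : pnorm (a *: z) <= complex.Re `|a| * pnorm z.
Proof.
have [->|a0] := eqVneq a 0; first by rewrite normr0 mul0r scale0r.
have c0 : 0 < complex.Re `|a|.
  by have := a0; rewrite -normr_gt0 ltcE => /andP[].
rewrite mulrC -ler_pdivrMr //; apply: lb_le_inf; first exact: pnorm_neq0.
move=> _ [s <- <-]; rewrite ler_pdivrMr // mulrC -fnormZ -apiZ.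
exact: pnorm_le.
Qed.

Fact pnormZ a z : pnorm (a *: z) = complex.Re `|a| * pnorm z.
Proof.
apply/eqP; rewrite eq_le pnormZ_le andTb.
have [->|a0] := eqVneq a 0; first by rewrite normr0 mul0r.
have := pnormZ_le a^-1 (a *: z); rewrite scalerA mulVf // scale1r => h.
apply: le_trans (ler_wpM2l _ h) _; first exact: Re_ge0.
by rewrite mulrA -ReMr // -normrM mulfV // normr1 mul1r.
Qed.

Definition pseminormed := Seminormed pnormD pnormZ.
End AlgebraicTensor.

(* The projective tensor product: the completion of the algebraic tensor product
   for the projective norm. *)
Definition ptensor {R : realType} (X Y : normedModType R[i]) := sepq (completion (pseminormed X Y)).

HB.instance Definition _ (R : realType) (X Y : normedModType R[i]) :=
  CompleteNormedModule.copy (ptensor X Y) (sepq (completion (pseminormed X Y))).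

Section ProjectiveTensor.
Context {R : realType} {X Y : normedModType R[i]}.
Local Notation T := (ptensor X Y).

Definition fin_tens (z : atens X Y) : T :=
  @spi R (completion (pseminormed X Y)) (@cconst R (pseminormed X Y) z).
Definition tens (x : X) (y : Y) : T := fin_tens (api [:: (x, y)]).

Lemma fin_tensD z w : fin_tens (z + w) = fin_tens z + fin_tens w.
Proof.
rewrite /fin_tens -spiD; congr spi; exact: cs_eq.
Qed.
Lemma fin_tensZ a z : fin_tens (a *: z) = a *: fin_tens z.
Proof. rewrite /fin_tens -spiZ; congr spi; exact: cs_eq. Qed.
Lemma fin_tens_sum s : fin_tens (api s) = \sum_(p <- s) tens p.1 p.2.
Proof.
elim: s => [|[x y] s IH].
  by rewrite big_nil api_nil -(scale0r (0 : atens X Y)) fin_tensZ scale0r.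
by rewrite big_cons -cat1s apiD fin_tensD IH.
Qed.
Lemma nrm_fin_tens z : nrm (fin_tens z) = pnorm z.
Proof. by rewrite /fin_tens [LHS]nrm_spi; exact: cseq_sn_const. Qed.

Lemma tens_linearl y a x x' : tens (a *: x + x') y = a *: tens x y + tens x' y.
Proof.
rewrite /tens -fin_tensZ -fin_tensD -apiZ -apiD; congr fin_tens.
by apply/api_eq; exact: teq_addl.
Qed.
Lemma tens_linearr x a y y' : tens x (a *: y + y') = a *: tens x y + tens x y'.
Proof.
rewrite /tens -fin_tensZ -fin_tensD -apiZ -apiD; congr fin_tens; apply/api_eq.
apply: (teq_trans (teq_addr _ _ _)); rewrite -cat1s; apply: teq_cat; last exact: teq_refl.
exact/teq_sym/teq_scale.
Qed.
Lemma nrm_tens x y : nrm (tens x y) <= nrm x * nrm y.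
Proof.
rewrite /tens nrm_fin_tens; apply: le_trans (pnorm_le _) _.
by rewrite /fnorm big_seq1.
Qed.

Lemma tens_dense (t : T) (e : R) : 0 < e ->
  exists s : seq (X * Y), nrm (t - \sum_(p <- s) tens p.1 p.2) < e /\ fnorm s < nrm t + e.
Proof.
move=> e0; have e3 := half_lt (half_lt e0).
have [u ->] := @spiP R (completion (pseminormed X Y)) t.
have [N /(_ _ (leqnn N)) hN] := @cseq_dense R (pseminormed X Y) u _ e3.
pose z := @cs R (pseminormed X Y) u N.
have hz : nrm (spi (u : completion (pseminormed X Y)) - fin_tens z : T) < e / 2%:R.
  rewrite /fin_tens -[X in nrm X](@spiB R (completion (pseminormed X Y)) u _) nrm_spi.
  apply: le_lt_trans hN _.
  by rewrite ltr_pdivrMr // mulr_natr mulr2n ltrDl half_lt.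
have [s sz hs] := pnorm_lt z (half_lt e0).
exists s; rewrite -fin_tens_sum sz; split.
  by apply: lt_trans hz _; rewrite ltr_pdivrMr // mulr_natr mulr2n ltrDl.
apply: lt_le_trans hs _; rewrite [X in _ <= _ + X](splitr e) addrA lerD2r -nrm_fin_tens.
set t0 := (X in _ <= nrm X + _) in hz *.
rewrite -(subrK t0 (fin_tens z)); apply: le_trans (nrmD _ _) _.
by rewrite addrC lerD2l nrmB ltW.
Qed.

(* [tlift B] is the bounded linear map on the projective tensor product with
   tlift B (x (x) y) = B x y, when B is a bounded bilinear map: see [tlift_tens],
   [tlift_linear], [nrm_tlift] and, for uniqueness, [tens_ext]. *)
Section Lift.
Variables (E : completeNormedModType R[i]) (B : X -> Y -> E).

Definition lift0 (s : seq (X * Y)) : E := \sum_(p <- s) B p.1 p.2.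
Definition lift1 (z : atens X Y) : E := lift0 (arepr z).
Definition tlift (t : T) : E :=
  limn (fun n => lift1 (@cs R (pseminormed X Y) (@srepr R (completion (pseminormed X Y)) t) n)).

Hypothesis Bl : forall y, linear (B ^~ y).
Hypothesis Br : forall x, linear (B x).
Variable M : R.
Hypothesis M0 : 0 <= M.
Hypothesis BM : forall x y, nrm (B x y) <= M * (nrm x * nrm y).

Let B0l y : B 0 y = 0.
Proof. by have := Bl y (-1) 0 0; rewrite scaler0 add0r scaleN1r addNr. Qed.
Let BDl x x' y : B (x + x') y = B x y + B x' y.
Proof. by have := Bl y 1 x x'; rewrite !scale1r. Qed.
Let BDr x y y' : B x (y + y') = B x y + B x y'.
Proof. by have := Br x 1 y y'; rewrite !scale1r. Qed.
Let BZl a x y : B (a *: x) y = a *: B x y.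
Proof. by have := Bl y a x 0; rewrite !addr0 B0l addr0. Qed.
Let B0r x : B x 0 = 0.
Proof. by have := Br x (-1) 0 0; rewrite scaler0 add0r scaleN1r addNr. Qed.
Let BZr a x y : B x (a *: y) = a *: B x y.
Proof. by have := Br x a y 0; rewrite !addr0 B0r addr0. Qed.

Lemma lift0_teq s t : teq s t -> lift0 s = lift0 t.
Proof.
rewrite /lift0; elim=> {s t} //=.
- by move=> s t r _ -> _ ->.
- by move=> s s' t t' _ h _ h'; rewrite !big_cat /= h h'.
- by move=> s t; rewrite !big_cat /= addrC.
- by move=> x x' y; rewrite !big_cons !big_nil /= !addr0 BDl.
- by move=> x y y'; rewrite !big_cons !big_nil /= !addr0 BDr.
- by move=> a x y; rewrite !big_cons !big_nil /= !addr0 BZl BZr.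
- by move=> y; rewrite !big_cons !big_nil /= !addr0 B0l.
Qed.
Lemma lift1E s : lift1 (api s) = lift0 s.
Proof. by apply: lift0_teq; exact: teq_repr. Qed.
Lemma lift1D z w : lift1 (z + w) = lift1 z + lift1 w.
Proof.
have [s ->] := apiP z; have [t ->] := apiP w.
by rewrite -apiD !lift1E /lift0 big_cat.
Qed.
Lemma lift1Z a z : lift1 (a *: z) = a *: lift1 z.
Proof.
have [s ->] := apiP z; rewrite -apiZ !lift1E /lift0 /fscale big_map scaler_sumr.
by apply: eq_bigr => -[x y] _ /=; rewrite BZl.
Qed.
Lemma lift1B z w : lift1 (z - w) = lift1 z - lift1 w.
Proof. by rewrite -scaleN1r lift1D lift1Z scaleN1r. Qed.
Lemma nrm_lift1 z : nrm (lift1 z) <= M * pnorm z.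
Proof.
have nl s : nrm (lift0 s) <= M * fnorm s.
  rewrite /lift0 /fnorm mulr_sumr; elim: s => [|p s IH].
    by rewrite !big_nil nrm0.
  by rewrite !big_cons; apply: le_trans (nrmD _ _) _; exact: lerD.
apply/ler_addgt0Pr => e e0.
have M1 : 0 < M + 1 by rewrite ltr_wpDl.
have [s <- hs] := pnorm_lt z (divr_gt0 e0 M1).
rewrite lift1E; apply: le_trans (nl s) _.
apply: le_trans (ler_wpM2l M0 (ltW hs)) _; rewrite mulrDr lerD2l.
by rewrite mulrA ler_pdivrMr // mulrC ler_pM2l // lerDl.
Qed.

Local Notation PC := (completion (pseminormed X Y)).
Local Notation csq u := (@cs R (pseminormed X Y) u).

Lemma lift1_cauchy (u : PC) : cvgn (fun n => lift1 (csq u n)).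
Proof.
have [l hl] : exists l : E, forall e : R, 0 < e -> exists N, forall n, (N <= n)%N -> nrm (lift1 (csq u n) - l) < e.
  apply: complete_seq => e e0.
  have M1 : 0 < M + 1 by rewrite ltr_wpDl.
  have [N hN] := @cseqP R (pseminormed X Y) u _ (divr_gt0 e0 M1).
  exists N => m n Nm Nn; rewrite -lift1B; apply: le_lt_trans (nrm_lift1 _) _.
  have h := hN _ _ Nm Nn.
  apply: (@le_lt_trans _ _ ((M + 1) * pnorm (csq u m - csq u n))).
    by rewrite ler_wpM2r ?lerDl // (@sn_ge0 R (pseminormed X Y)).
  by rewrite mulrC -ltr_pdivlMr.
by apply/cvg_ex; exists l; apply/cvg_nrmP.
Qed.

Lemma tlift_cvg (u : PC) : (fun n => lift1 (csq u n)) @ \oo --> tlift (spi u).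
Proof.
pose v := srepr (spi u : sepq PC).
have /cvg_nrmP hv : (fun n => lift1 (csq v n)) @ \oo --> tlift (spi u) by exact: lift1_cauchy.
apply/cvg_nrmP => e e0.
have [N hN] := hv _ (half_lt e0).
have M1 : 0 < M + 1 by rewrite ltr_wpDl.
have uv : cseq_sn (v - u : cseq _) = 0 by exact: (@sn_srepr R PC u).
have := @cseq_sn_cvg R (pseminormed X Y) (v - u : cseq _).
rewrite uv => /cvgrPdist_lt/(_ _ (divr_gt0 (half_lt e0) M1)) [K _ hK].
exists (maxn N K) => n; rewrite geq_max => /andP[Nn Kn].
rewrite -(subrK (lift1 (csq v n)) (lift1 (csq u n))) -addrA.
apply: le_lt_trans (nrmD _ _) _; rewrite (splitr e) ltrD ?hN //.
rewrite nrmB -lift1B; apply: le_lt_trans (nrm_lift1 _) _.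
have := hK n Kn; rewrite /= sub0r normrN ger0_norm ?(@sn_ge0 R (pseminormed X Y)) //.
move=> h.
apply: (@le_lt_trans _ _ ((M + 1) * pnorm (csq v n - csq u n))).
  by rewrite ler_wpM2r ?lerDl // (@sn_ge0 R (pseminormed X Y)).
by rewrite mulrC -ltr_pdivlMr.
Qed.

Lemma tlift_fin z : tlift (fin_tens z) = lift1 z.
Proof.
have h := @tlift_cvg (@cconst R (pseminormed X Y) z : PC).
have h' : (fun n : nat => lift1 z) @ \oo --> lift1 z by exact: cvg_cst.
exact: (cvg_unique _ h h').
Qed.

Lemma tlift_tens x y : tlift (tens x y) = B x y.
Proof. by rewrite tlift_fin lift1E /lift0 big_seq1. Qed.

Lemma tlift_linear : linear tlift.
Proof.
move=> a t t'.
have [u ->] := @spiP R PC t; have [v ->] := @spiP R PC t'.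
rewrite -[X in tlift X](_ : spi (a *: u + v) = _); last by rewrite spiD spiZ.
have h := @tlift_cvg (a *: u + v).
have h' : (fun n => a *: lift1 (csq u n) + lift1 (csq v n)) @ \oo --> a *: tlift (spi u) + tlift (spi v).
  by apply: cvgD; [apply: cvgZr|]; exact: tlift_cvg.
have e : (fun n => lift1 (csq (a *: u + v) n)) = (fun n => a *: lift1 (csq u n) + lift1 (csq v n)).
  by apply/funext => n; rewrite -lift1Z -lift1D.
by rewrite e in h; exact: (cvg_unique _ h h').
Qed.

Lemma nrm_tlift t : nrm (tlift t) <= M * nrm t.
Proof.
apply/ler_addgt0Pr => e e0.
have [u ->] := @spiP R PC t.
have /cvg_nrmP/(_ _ (half_lt e0)) [N hN] := @tlift_cvg u.
have M1 : 0 < M + 1 by rewrite ltr_wpDl.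
have := @cseq_sn_cvg R (pseminormed X Y) u.
move=> /cvgrPdist_lt/(_ _ (divr_gt0 (half_lt e0) M1)) [K _ hK].
pose n := maxn N K.
have h1 := hN n (leq_maxl _ _); have h2 := hK n (leq_maxr _ _).
rewrite -(subrK (lift1 (csq u n)) (tlift _)); apply: le_trans (nrmD _ _) _.
rewrite addrC (splitr e) addrA lerD //; last by rewrite nrmB ltW.
apply: le_trans (nrm_lift1 _) _.
have h3 : pnorm (csq u n) <= cseq_sn u + e / 2%:R / (M + 1).
  by move: h2; rewrite /= distrC => /ltW/(le_trans (ler_norm _)); rewrite lerBlDl.
apply: le_trans (ler_wpM2l M0 h3) _; rewrite mulrDr [nrm _]nrm_spi lerD2l.
by rewrite mulrA ler_pdivrMr // mulrC ler_pM2l ?half_lt // lerDl.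
Qed.
End Lift.

Lemma tens_eq0 (E : normedModType R[i]) (f : T -> E) (M : R) :
  (forall t t', f (t + t') = f t + f t') -> (forall t, nrm (f t) <= M * nrm t) ->
  (forall x y, f (tens x y) = 0) -> forall t, f t = 0.
Proof.
move=> fD fM f0 t; apply: nrm0_eq0; apply/eqP; rewrite eq_le nrm_ge0 andbT.
have M1 : 0 < `|M| + 1 by rewrite ltr_wpDl.
have f00 : f 0 = 0 by apply: (addrI (f 0)); rewrite -fD !addr0.
have fs s : f (\sum_(p <- s) tens p.1 p.2) = 0.
  elim: s => [|p s IH]; first by rewrite big_nil.
  by rewrite big_cons fD f0 IH addr0.
apply/ler_addgt0Pr => e e0; rewrite add0r.
have [s [h _]] := tens_dense t (divr_gt0 e0 M1).
rewrite -(subrK (\sum_(p <- s) tens p.1 p.2) t) fD fs addr0.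
apply: le_trans (fM _) _.
apply: (@le_trans _ _ ((`|M| + 1) * nrm (t - \sum_(p <- s) tens p.1 p.2))).
  by rewrite ler_wpM2r ?nrm_ge0 // (le_trans (ler_norm M)) // lerDl.
by rewrite mulrC -ler_pdivlMr // ltW.
Qed.

Lemma tens_ext (E : normedModType R[i]) (f g : T -> E) (M N : R) :
  (forall t t', f (t + t') = f t + f t') -> (forall t, nrm (f t) <= M * nrm t) ->
  (forall t t', g (t + t') = g t + g t') -> (forall t, nrm (g t) <= N * nrm t) ->
  (forall x y, f (tens x y) = g (tens x y)) -> forall t, f t = g t.
Proof.
move=> fD fM gD gM fg t; apply/eqP; rewrite -subr_eq0; apply/eqP; move: t.
apply: (@tens_eq0 E (fun t => f t - g t) (M + N)).
- by move=> t t'; rewrite fD gD opprD addrACA.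
- move=> t; apply: le_trans (nrmD _ _) _; rewrite nrmN mulrDl; exact: lerD.
- by move=> x y; rewrite fg subrr.
Qed.
End ProjectiveTensor.

(* Complex Banach algebras, not assumed to be unital. *)
HB.mixin Record isBanachAlgebra (R : realType) A & CompleteNormedModule R[i] A := {
  bmul : A -> A -> A;
  bmulA : associative bmul;
  bmul_linearl : forall y, linear (bmul ^~ y);
  bmul_linearr : forall x, linear (bmul x);
  norm_bmul : forall x y, `|bmul x y| <= `|x| * `|y|
}.

#[short(type="banachAlgType")]
HB.structure Definition BanachAlgebra (R : realType) :=
  {A of CompleteNormedModule R[i] A & isBanachAlgebra R A}.

Notation "x *b y" := (bmul x y) (at level 40, left associativity) : ring_scope.

Section LinearTheory.
Context {R : realType} {U V : lmodType R[i]} {f : U -> V}.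
Hypothesis fl : linear f.
Lemma linD x y : f (x + y) = f x + f y.
Proof. by have := fl 1 x y; rewrite !scale1r. Qed.
Lemma lin0 : f 0 = 0.
Proof. by apply: (addrI (f 0)); rewrite -linD !addr0. Qed.
Lemma linZ a x : f (a *: x) = a *: f x.
Proof. by have := fl a x 0; rewrite !addr0 lin0 addr0. Qed.
Lemma linN x : f (- x) = - f x.
Proof. by rewrite -scaleN1r linZ scaleN1r. Qed.
Lemma linB x y : f (x - y) = f x - f y.
Proof. by rewrite linD linN. Qed.
End LinearTheory.

Section BanachAlgebraTheory.
Context {R : realType} {A : banachAlgType R}.
Implicit Types x y z : A.
Lemma nrm_bmul x y : nrm (x *b y) <= nrm x * nrm y.
Proof. by have := norm_bmul x y; rewrite !nrmE -rmorphM lecR. Qed.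
Lemma bmulDl x y z : (x + y) *b z = x *b z + y *b z.
Proof. exact: (linD (bmul_linearl z)). Qed.
Lemma bmulDr x y z : x *b (y + z) = x *b y + x *b z.
Proof. exact: (linD (bmul_linearr x)). Qed.
Lemma bmulZl a x y : (a *: x) *b y = a *: (x *b y).
Proof. exact: (linZ (bmul_linearl y)). Qed.
Lemma bmulZr a x y : x *b (a *: y) = a *: (x *b y).
Proof. exact: (linZ (bmul_linearr x)). Qed.
Lemma bmulBl x y z : (x - y) *b z = x *b z - y *b z.
Proof. exact: (linB (bmul_linearl z)). Qed.
Lemma bmulBr x y z : x *b (y - z) = x *b y - x *b z.
Proof. exact: (linB (bmul_linearr x)). Qed.
End BanachAlgebraTheory.

Definition closed_ideal {R : realType} {A : banachAlgType R} (J : set A) : Prop :=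
  [/\ closed J, J 0, (forall (a : R[i]) x y, J x -> J y -> J (a *: x + y)),
      (forall a x, J x -> J (a *b x)) & (forall a x, J x -> J (x *b a))].

Record closedIdeal {R : realType} (A : banachAlgType R) := ClosedIdeal {
  ci_set :> set A;
  ciP : closed_ideal ci_set
}.

(* The closed two-sided ideal generated by S. *)
Definition gen_set {R : realType} {A : banachAlgType R} (S : set A) : set A :=
  [set x | forall J, closed_ideal J -> S `<=` J -> J x].

Fact gen_closed_ideal {R : realType} {A : banachAlgType R} (S : set A) : closed_ideal (gen_set S).
Proof.
split.
- have -> : gen_set S = \bigcap_(J in [set J | closed_ideal J /\ S `<=` J]) J.
    apply/seteqP; split=> x h J; first by case; exact: h.
    by move=> cJ SJ; apply: h.
  by apply: closed_bigI => J [[]].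
- by move=> J [].
- by move=> a x y hx hy J cJ SJ; case: (cJ) => _ _ h _ _; apply: h; [exact: hx|exact: hy].
- by move=> a x hx J cJ SJ; case: (cJ) => _ _ _ h _; apply: h; exact: hx.
- by move=> a x hx J cJ SJ; case: (cJ) => _ _ _ _ h; apply: h; exact: hx.
Qed.

Definition gen_ideal {R : realType} {A : banachAlgType R} (S : set A) : closedIdeal A :=
  ClosedIdeal (gen_closed_ideal S).

(* The Banach algebra A / J: see [qpi_eq], [nrm_qpi] and [qpiM]. *)
Section QuotientAlgebra.
Context {R : realType} {A : banachAlgType R} (J : closedIdeal A).

Fact ci0 : ci_set J 0. Proof. by case: (ciP J). Qed.
Fact ciL : forall (a : R[i]) x y, ci_set J x -> ci_set J y -> ci_set J (a *: x + y).
Proof. by case: (ciP J). Qed.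
Lemma ci_mull a x : ci_set J x -> ci_set J (a *b x). Proof. by case: (ciP J) => _ _ _ h _; exact: h. Qed.
Lemma ci_mulr a x : ci_set J x -> ci_set J (x *b a). Proof. by case: (ciP J) => _ _ _ _; apply. Qed.
Lemma ciD x y : ci_set J x -> ci_set J y -> ci_set J (x + y).
Proof. by move=> ? ?; rewrite -[x]scale1r; exact: ciL. Qed.
Lemma ci_closed : closed (J : set A). Proof. by case: (ciP J). Qed.

Definition quot_csn := dist_complete_seminormed ci0 ciL.
Definition quotalg := sepq quot_csn.
HB.instance Definition _ := CompleteNormedModule.copy quotalg (sepq quot_csn).

Definition qpi (x : A) : quotalg := @spi R quot_csn x.
Definition qrepr (z : quotalg) : A := @srepr R quot_csn z.

Lemma qreprK z : qpi (qrepr z) = z. Proof. exact: sreprK. Qed.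
Lemma qpiP z : exists x, z = qpi x. Proof. by exists (qrepr z); rewrite qreprK. Qed.
Lemma qpi_linear : linear qpi.
Proof. by move=> a x y; rewrite /qpi [LHS]spiD; congr (_ + _); exact: spiZ. Qed.
Lemma qpi_eq x y : qpi x = qpi y <-> ci_set J (x - y).
Proof.
rewrite /qpi; split=> [/spi_eq h|h]; last by apply/spi_eq; exact: (dist_J (J := J) ci0 ciL h).
exact: (dist0_J (J := J) ci0 ciL ci_closed h).
Qed.
Lemma nrm_qpi x : nrm (qpi x) = inf [set nrm (x + j) | j in J].
Proof. exact: nrm_spi. Qed.

Definition qmul (z w : quotalg) : quotalg := qpi (qrepr z *b qrepr w).
Lemma qmulE x y : qmul (qpi x) (qpi y) = qpi (x *b y).
Proof.
apply/qpi_eq.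
have hx : ci_set J (qrepr (qpi x) - x) by apply/qpi_eq; rewrite qreprK.
have hy : ci_set J (qrepr (qpi y) - y) by apply/qpi_eq; rewrite qreprK.
have := ciD (ci_mulr (qrepr (qpi y)) hx) (ci_mull x hy).
by rewrite bmulBl bmulBr subrKA.
Qed.
Fact qmulA : associative qmul.
Proof.
move=> z w v; have [x ->] := qpiP z; have [y ->] := qpiP w; have [u ->] := qpiP v.
by rewrite !qmulE bmulA.
Qed.
Fact qmul_linearl w : linear (qmul ^~ w).
Proof.
move=> a z z'; have [x ->] := qpiP z; have [x' ->] := qpiP z'; have [y ->] := qpiP w.
by rewrite -qpi_linear !qmulE bmul_linearl qpi_linear.
Qed.
Fact qmul_linearr w : linear (qmul w).
Proof.
move=> a z z'; have [x ->] := qpiP z; have [x' ->] := qpiP z'; have [y ->] := qpiP w.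
by rewrite -qpi_linear !qmulE bmul_linearr qpi_linear.
Qed.
Fact norm_qmul z w : `|qmul z w| <= `|z| * `|w|.
Proof.
have [x ->] := qpiP z; have [y ->] := qpiP w.
rewrite qmulE !nrmE -rmorphM lecR !nrm_qpi -!/(dist _ _).
have Jn := dist_neq0 ci0.
have key j k : ci_set J j -> ci_set J k -> dist J (x *b y) <= nrm (x + j) * nrm (y + k).
  move=> Jj Jk; apply: le_trans (nrm_bmul _ _).
  rewrite bmulDl bmulDr -addrA; apply: dist_le.
  by apply: ciD; [exact: ci_mull|exact: ci_mulr].
have dx : 0 <= dist J x by apply: lb_le_inf => // _ [j _ <-]; exact: nrm_ge0.
have step k : ci_set J k -> dist J (x *b y) <= dist J x * nrm (y + k).
  move=> Jk; have [n0|n0] := eqVneq (nrm (y + k)) 0.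
    by have := key 0 k ci0 Jk; rewrite n0 !mulr0.
  have p0 : 0 < nrm (y + k) by rewrite lt_neqAle eq_sym n0 nrm_ge0.
  rewrite -ler_pdivrMr //; apply: lb_le_inf => // _ [j Jj <-].
  by rewrite ler_pdivrMr //; exact: key.
have [n0|n0] := eqVneq (dist J x) 0.
  by have := step 0 ci0; rewrite n0 !mul0r.
have p0 : 0 < dist J x by rewrite lt_neqAle eq_sym n0.
rewrite mulrC -ler_pdivrMr //; apply: lb_le_inf => // _ [k Jk <-].
by rewrite ler_pdivrMr // mulrC; exact: step.
Qed.
HB.instance Definition _ := isBanachAlgebra.Build R quotalg qmulA qmul_linearl qmul_linearr norm_qmul.

Lemma qpiM x y : qpi (x *b y) = qpi x *b qpi y.
Proof. by rewrite -qmulE. Qed.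
End QuotientAlgebra.

Section InducedMap.
Context {R : realType} {A B : banachAlgType R} {I : closedIdeal A} {J : closedIdeal B}.
(* The map x + I |-> f x + J.  The value is computed on a chosen representative
   of the class; it does not depend on that choice when f is linear and maps I
   into J ([inducedE]). *)
Definition induced (f : A -> B) (z : quotalg I) : quotalg J := qpi J (f (qrepr z)).

Lemma inducedE f : linear f -> (forall x, ci_set I x -> ci_set J (f x)) ->
  forall x, induced f (qpi I x) = qpi J (f x).
Proof.
move=> fl fIJ x; apply/qpi_eq; rewrite -linB //; apply: fIJ.
by apply/qpi_eq; rewrite qreprK.
Qed.
End InducedMap.

(* The product of the projective tensor product of two Banach algebras, with
   (a (x) b) (c (x) d) = ac (x) bd ([tensM]): [rmul c d] is the right
   multiplication by c (x) d. *)
Section TensorAlgebra.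
Context {R : realType} {A B : banachAlgType R}.
Local Notation T := (ptensor A B).

Lemma tens_ext_linear (X Y E : normedModType R[i]) (f g : ptensor X Y -> E) (M N : R) :
  linear f -> (forall t, nrm (f t) <= M * nrm t) ->
  linear g -> (forall t, nrm (g t) <= N * nrm t) ->
  (forall x y, f (tens x y) = g (tens x y)) -> forall t, f t = g t.
Proof. by move=> fl fM gl gN; apply: tens_ext fM _ gN; exact: linD. Qed.

Definition rmul (c : A) (d : B) (u : T) : T := tlift (fun a b => tens (a *b c) (b *b d)) u.

Let rl c d : forall b, linear (fun a : A => tens (a *b c) (b *b d) : T).
Proof. by move=> b k a a'; rewrite bmul_linearl tens_linearl. Qed.
Let rr c d : forall a, linear (fun b : B => tens (a *b c) (b *b d) : T).
Proof. by move=> a k b b'; rewrite bmul_linearl tens_linearr. Qed.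
Let rM0 (c : A) (d : B) : 0 <= nrm c * nrm d.
Proof. by rewrite mulr_ge0 ?nrm_ge0. Qed.
Let rM c d : forall a b, nrm (tens (a *b c) (b *b d) : T) <= nrm c * nrm d * (nrm a * nrm b).
Proof.
move=> a b; apply: le_trans (nrm_tens _ _) _.
rewrite [X in _ <= X]mulrC mulrACA.
by apply: ler_pM; rewrite ?nrm_ge0 ?nrm_bmul.
Qed.

Lemma rmul_tens c d a b : rmul c d (tens a b) = tens (a *b c) (b *b d).
Proof. exact: (tlift_tens (rl c d) (rr c d) (rM0 c d) (rM c d)). Qed.
Lemma rmul_linear c d : linear (rmul c d).
Proof. exact: (tlift_linear (rl c d) (rr c d) (rM0 c d) (rM c d)). Qed.
Lemma nrm_rmul c d u : nrm (rmul c d u) <= nrm c * nrm d * nrm u.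
Proof. exact: (nrm_tlift (rl c d) (rr c d) (rM0 c d) (rM c d)). Qed.

Lemma nrm_lincomb (E : normedModType R[i]) (k : R[i]) (v w : E) (K M N : R) :
  nrm v <= M * K -> nrm w <= N * K -> nrm (k *: v + w) <= (complex.Re `|k| * M + N) * K.
Proof.
move=> hv hw; apply: le_trans (nrmD _ _) _; rewrite nrmZ mulrDl -mulrA lerD //.
by rewrite ler_wpM2l // Re_ge0.
Qed.
Lemma linear_lincomb (U V : lmodType R[i]) (k : R[i]) (f g : U -> V) :
  linear f -> linear g -> linear (fun u => k *: f u + g u).
Proof.
move=> fl gl a u v; rewrite fl gl !scalerDr !scalerA.
by rewrite addrACA [k * a]mulrC.
Qed.

Let rmul_cl u : forall d, linear (fun c => rmul c d u).
Proof.
move=> d k c c'; move: u.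
apply: (tens_ext_linear (rmul_linear _ _) (nrm_rmul _ _)
  (linear_lincomb k (rmul_linear c d) (rmul_linear c' d))
  (fun u => nrm_lincomb k (nrm_rmul c d u) (nrm_rmul c' d u))).
by move=> a b; rewrite !rmul_tens bmul_linearr tens_linearl.
Qed.
Let rmul_dl u : forall c, linear (fun d => rmul c d u).
Proof.
move=> c k d d'; move: u.
apply: (tens_ext_linear (rmul_linear _ _) (nrm_rmul _ _)
  (linear_lincomb k (rmul_linear c d) (rmul_linear c d'))
  (fun u => nrm_lincomb k (nrm_rmul c d u) (nrm_rmul c d' u))).
by move=> a b; rewrite !rmul_tens bmul_linearr tens_linearr.
Qed.
Let rmul_M u : forall c d, nrm (rmul c d u) <= nrm u * (nrm c * nrm d).
Proof. by move=> c d; rewrite mulrC nrm_rmul. Qed.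

Definition tmul (u v : T) : T := tlift (fun c d => rmul c d u) v.

Lemma tmul_tensr u c d : tmul u (tens c d) = rmul c d u.
Proof. exact: (tlift_tens (rmul_cl u) (rmul_dl u) (nrm_ge0 u) (rmul_M u)). Qed.
Fact tmul_linearr u : linear (tmul u).
Proof. exact: (tlift_linear (rmul_cl u) (rmul_dl u) (nrm_ge0 u) (rmul_M u)). Qed.
Fact nrm_tmul u v : nrm (tmul u v) <= nrm u * nrm v.
Proof. exact: (nrm_tlift (rmul_cl u) (rmul_dl u) (nrm_ge0 u) (rmul_M u)). Qed.
Fact tmul_linearl v : linear (tmul ^~ v).
Proof.
move=> k u u'; move: v.
apply: (tens_ext_linear (tmul_linearr _) (nrm_tmul _)
  (linear_lincomb k (tmul_linearr u) (tmul_linearr u'))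
  (fun v => nrm_lincomb k (nrm_tmul u v) (nrm_tmul u' v))).
by move=> c d; rewrite !tmul_tensr rmul_linear.
Qed.
Lemma tmul_tens a b c d : tmul (tens a b) (tens c d) = tens (a *b c) (b *b d).
Proof. by rewrite tmul_tensr rmul_tens. Qed.

Let lin_comp (U V W : lmodType R[i]) (f : V -> W) (g : U -> V) :
  linear f -> linear g -> linear (fun x => f (g x)).
Proof. by move=> fl gl a x y; rewrite gl fl. Qed.
Let b3l u v w : nrm (tmul (tmul u v) w) <= nrm u * nrm v * nrm w.
Proof. by apply: le_trans (nrm_tmul _ _) _; rewrite ler_wpM2r ?nrm_ge0 // nrm_tmul. Qed.
Let b3r u v w : nrm (tmul u (tmul v w)) <= nrm u * nrm v * nrm w.
Proof. by rewrite -mulrA; apply: le_trans (nrm_tmul _ _) _; rewrite ler_wpM2l ?nrm_ge0 // nrm_tmul. Qed.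

Fact tmulA : associative tmul.
Proof.
move=> u v w; move: w.
apply: (tens_ext_linear (M := nrm u * nrm v) (N := nrm u * nrm v)).
- exact: lin_comp (tmul_linearr u) (tmul_linearr v).
- by move=> w; exact: b3r.
- exact: tmul_linearr.
- by move=> w; exact: b3l.
move=> c3 d3; move: v.
apply: (tens_ext_linear (M := nrm u * nrm (tens c3 d3 : T)) (N := nrm u * nrm (tens c3 d3 : T))).
- exact: lin_comp (tmul_linearr u) (tmul_linearl _).
- by move=> w; apply: le_trans (b3r _ _ _) _; rewrite mulrAC.
- exact: lin_comp (tmul_linearl _) (tmul_linearr u).
- by move=> w; apply: le_trans (b3l _ _ _) _; rewrite mulrAC.
move=> c2 d2; move: u.
pose K := nrm (tens c2 d2 : T) * nrm (tens c3 d3 : T).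
apply: (tens_ext_linear (M := K) (N := K)).
- exact: tmul_linearl.
- by move=> w; apply: le_trans (b3r _ _ _) _; rewrite -mulrA mulrC.
- exact: lin_comp (tmul_linearl _) (tmul_linearl _).
- by move=> w; apply: le_trans (b3l _ _ _) _; rewrite -mulrA mulrC.
by move=> c1 d1; rewrite !tmul_tens !bmulA.
Qed.

Fact norm_tmul (u v : T) : `|tmul u v| <= `|u| * `|v|.
Proof. by rewrite !nrmE -rmorphM lecR nrm_tmul. Qed.
HB.instance Definition _ := isBanachAlgebra.Build R (ptensor A B) tmulA tmul_linearl tmul_linearr norm_tmul.

Lemma tensM a b c d : (tens a b : T) *b tens c d = tens (a *b c) (b *b d).
Proof. exact: tmul_tens. Qed.
End TensorAlgebra.

Section Biprojective.
Context {R : realType}.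

Definition bounded_map (X Y : normedModType R[i]) (f : X -> Y) : Prop :=
  exists M : R[i], forall x, `|f x| <= M * `|x|.

Section Canonical.
Context {A : banachAlgType R}.
Local Notation AA := (ptensor A A).

(* The product map, and the left and right actions of A on the projective tensor
   product of A with itself: see [omega_tens], [tlact_tens], [tract_tens]. *)
Definition omega : AA -> A := tlift (fun a b => a *b b).
Definition tlact (a : A) : AA -> AA := tlift (fun b c => tens (a *b b) c).
Definition tract (u : AA) (a : A) : AA := tlift (fun b c => tens b (c *b a)) u.

Let o_l : forall b, linear (fun a : A => a *b b). Proof. exact: bmul_linearl. Qed.
Let o_r : forall a, linear (fun b : A => a *b b). Proof. exact: bmul_linearr. Qed.
Let o_M : forall a b : A, nrm (a *b b) <= 1 * (nrm a * nrm b).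
Proof. by move=> a b; rewrite mul1r nrm_bmul. Qed.

Lemma omega_tens a b : omega (tens a b) = a *b b.
Proof. exact: (tlift_tens o_l o_r ler01 o_M). Qed.
Lemma omega_linear : linear omega.
Proof. exact: (tlift_linear o_l o_r ler01 o_M). Qed.

Let l_l a : forall c, linear (fun b : A => tens (a *b b) c : AA).
Proof. by move=> c k b b'; rewrite bmul_linearr tens_linearl. Qed.
Let l_r a : forall b, linear (fun c : A => tens (a *b b) c : AA).
Proof. by move=> b k c c'; rewrite tens_linearr. Qed.
Let l_M a : forall b c, nrm (tens (a *b b) c : AA) <= nrm a * (nrm b * nrm c).
Proof.
move=> b c; apply: le_trans (nrm_tens _ _) _.
by rewrite mulrA ler_wpM2r ?nrm_ge0 ?nrm_bmul.
Qed.

Lemma tlact_tens a b c : tlact a (tens b c) = tens (a *b b) c.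
Proof. exact: (tlift_tens (l_l a) (l_r a) (nrm_ge0 a) (l_M a)). Qed.
Lemma tlact_linear a : linear (tlact a).
Proof. exact: (tlift_linear (l_l a) (l_r a) (nrm_ge0 a) (l_M a)). Qed.

Let r_l a : forall c, linear (fun b : A => tens b (c *b a) : AA).
Proof. by move=> c k b b'; rewrite tens_linearl. Qed.
Let r_r a : forall b, linear (fun c : A => tens b (c *b a) : AA).
Proof. by move=> b k c c'; rewrite bmul_linearl tens_linearr. Qed.
Let r_M a : forall b c, nrm (tens b (c *b a) : AA) <= nrm a * (nrm b * nrm c).
Proof.
move=> b c; apply: le_trans (nrm_tens _ _) _.
by rewrite mulrCA ler_wpM2l ?nrm_ge0 // mulrC nrm_bmul.
Qed.

Lemma tract_tens a b c : tract (tens b c) a = tens b (c *b a).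
Proof. exact: (tlift_tens (r_l a) (r_r a) (nrm_ge0 a) (r_M a)). Qed.
Lemma tract_linear a : linear (tract ^~ a).
Proof. exact: (tlift_linear (r_l a) (r_r a) (nrm_ge0 a) (r_M a)). Qed.
End Canonical.

Definition biprojective (B : banachAlgType R) : Prop :=
  exists rho : B -> ptensor B B,
    [/\ linear rho, bounded_map rho, cancel rho omega,
        (forall a b, rho (a *b b) = tlact a (rho b)) &
        (forall a b, rho (b *b a) = tract (rho b) a)].

(* A Banach F-bimodule X: the actions are jointly continuous, with constants that
   need not be 1. *)
Record banachBimodule (F : banachAlgType R) (X : completeNormedModType R[i]) := BanachBimodule {
  lact : F -> X -> X;
  ract : X -> F -> X;
  lact_linearl : forall x, linear (lact ^~ x);
  lact_linearr : forall al, linear (lact al);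
  ract_linearl : forall al, linear (ract ^~ al);
  ract_linearr : forall x, linear (ract x);
  lactA : forall al be x, lact (al *b be) x = lact al (lact be x);
  ractA : forall x al be, ract x (al *b be) = ract (ract x al) be;
  lractA : forall al x be, ract (lact al x) be = lact al (ract x be);
  lact_bounded : exists M : R[i], forall al x, `|lact al x| <= M * (`|al| * `|x|);
  ract_bounded : exists M : R[i], forall x al, `|ract x al| <= M * (`|x| * `|al|)
}.

Definition directed (D : Type) (le : D -> D -> Prop) : Prop :=
  [/\ inhabited D, (forall i, le i i), (forall i j k, le i j -> le j k -> le i k) &
      (forall i j, exists k, le i k /\ le j k)].

Definition net_cvg (D : Type) (le : D -> D -> Prop) (V : normedModType R[i])
    (x : D -> V) (l : V) : Prop :=
  forall e : R[i], 0 < e -> exists j0, forall j, le j0 j -> `|x j - l| < e.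

Section ModuleBiprojective.
Context {F A : banachAlgType R} (M : banachBimodule F A).
Local Notation AA := (ptensor A A).

Definition compatible_actions : Prop :=
  (forall al a b, lact M al (a *b b) = lact M al a *b b) /\
  (forall a b al, ract M (a *b b) al = a *b ract M b al).

Definition trivial_left_action : Prop :=
  exists f : F -> R[i]^o,
    [/\ linear f, continuous f & forall al a, lact M al a = f al *: a].

Definition has_bounded_approximate_identity : Prop :=
  exists (D : Type) (le : D -> D -> Prop) (al : D -> F),
    [/\ directed le, (exists K : R[i], forall j, `|al j| <= K) &
      forall a : A, net_cvg le (fun j => lact M (al j) a) a /\
                    net_cvg le (fun j => ract M a (al j)) a].

(* The actions of F on the projective tensor product of A with itself: see
   [tmlact_tens] and [tmract_tens]. *)
Definition tmlact (al : F) : AA -> AA := tlift (fun b c => tens (lact M al b) c).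
Definition tmract (u : AA) (al : F) : AA := tlift (fun b c => tens b (ract M c al)) u.

Let real_bound (K : R[i]) (V : normedModType R[i]) (v : V) (a b : R) :
  `|v| <= K * (a%:C * b%:C) -> 0 <= a -> 0 <= b -> nrm v <= `|complex.Re K| * (a * b).
Proof.
rewrite nrmE -rmorphM lecE => /andP[_ h] a0 b0; apply: le_trans h _.
case: K => k l /=; rewrite mulr0 subr0.
by rewrite ler_wpM2r ?mulr_ge0 // ler_norm.
Qed.

Lemma tmlact_tens al b c : tmlact al (tens b c) = tens (lact M al b) c.
Proof.
have [K hK] := lact_bounded M.
have BM x y : nrm (tens (lact M al x) y : AA) <= (`|complex.Re K| * nrm al) * (nrm x * nrm y).
  apply: le_trans (nrm_tens _ _) _; rewrite mulrA ler_wpM2r ?nrm_ge0 // -mulrA.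
  by apply: real_bound; rewrite ?nrm_ge0 // -!nrmE.
have Bl y : linear (fun x => tens (lact M al x) y : AA).
  by move=> k x x'; rewrite lact_linearr tens_linearl.
have Br x : linear (fun y => tens (lact M al x) y : AA).
  by move=> k y y'; rewrite tens_linearr.
have M0 : 0 <= `|complex.Re K| * nrm al by rewrite mulr_ge0 ?nrm_ge0.
exact: (tlift_tens Bl Br M0 BM).
Qed.

Lemma tmract_tens al b c : tmract (tens b c) al = tens b (ract M c al).
Proof.
have [K hK] := ract_bounded M.
have BM x y : nrm (tens x (ract M y al) : AA) <= (`|complex.Re K| * nrm al) * (nrm x * nrm y).
  apply: le_trans (nrm_tens _ _) _; rewrite mulrCA ler_wpM2l ?nrm_ge0 // -mulrA [nrm al * _]mulrC.
  by apply: real_bound; rewrite ?nrm_ge0 // -!nrmE.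
have Bl y : linear (fun x => tens x (ract M y al) : AA).
  by move=> k x x'; rewrite tens_linearl.
have Br x : linear (fun y => tens x (ract M y al) : AA).
  by move=> k y y'; rewrite ract_linearl tens_linearr.
have M0 : 0 <= `|complex.Re K| * nrm al by rewrite mulr_ge0 ?nrm_ge0.
exact: (tlift_tens Bl Br M0 BM).
Qed.

Definition idealI : closedIdeal AA :=
  gen_ideal [set u | exists al a b, u = tens (lact M al a) b - tens a (ract M b al)].
Definition idealJ : closedIdeal A := gen_ideal (omega @` idealI).

Local Notation QT := (quotalg idealI).
Local Notation QA := (quotalg idealJ).

Definition omega_tilde : QT -> QA := induced omega.

Lemma omega_tildeE u : omega_tilde (qpi idealI u) = qpi idealJ (omega u).
Proof.
apply: inducedE; first exact: omega_linear.
by move=> x Ix J _; apply; exists x.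
Qed.

(* F and A act on the two quotients through the induced maps.  A morphism is
   additive, but is not assumed to be homogeneous for the complex scalars. *)
Record module_morphism (phi : QA -> QT) : Prop := {
  mm_continuous : continuous phi;
  mm_additive : forall x y, phi (x + y) = phi x + phi y;
  mm_lact : forall al x, phi (induced (lact M al) x) = induced (tmlact al) (phi x);
  mm_ract : forall al x, phi (induced (ract M ^~ al) x) = induced (tmract ^~ al) (phi x);
  mm_mull : forall (a : A) x, phi (induced (bmul a) x) = induced (tlact a) (phi x);
  mm_mulr : forall (a : A) x, phi (induced (bmul ^~ a) x) = induced (tract ^~ a) (phi x)
}.

Definition module_biprojective : Prop :=
  exists rho : QA -> QT,
    [/\ bounded_map rho, cancel rho omega_tilde & module_morphism rho].
End ModuleBiprojective.
End Biprojective.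

(* Main.v *)
Require Import Defs.
From HB Require Import structures.
From mathcomp Require Import all_boot all_order all_algebra.
From mathcomp Require Import complex.
From mathcomp Require Import all_classical all_reals topology normedtype.

(** Write B for A/J and pi for the projection of A onto B, and let f be the
    functional through which F acts from the left.  Modulo J the right action of
    F is given by f as well ([trivial_right_action_mod]): if e is a left identity
    modulo J, then b.al = e (b.al) = (al.e) b = f(al) e b = f(al) b modulo J, the
    second equality holding because al.e (x) b - e (x) b.al lies in I.  Hence the
    algebra morphism pi (x) pi from the tensor square of A to that of B
    annihilates the generators of I, and so I itself, since its kernel is a
    closed ideal ([tmap_idealI]).  It therefore induces a bounded linear map
    Phi from the quotient by I, which commutes with the actions of A on both
    sides and intertwines the two product maps.

    Let rho be a right inverse of the induced product map witnessing module
    biprojectivity.  Then Phi \o rho is a bounded additive right inverse of the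
    product map of B, and a bimodule map.  What is not immediate is that it is
    complex linear.  This comes from the left action of F: rho commutes with it,
    so rho (f(al) x) = f(al) rho x, and f takes all complex values unless it
    vanishes identically.  In the latter case a net of elements of F acting as
    an approximate identity forces A = 0. *)

Set Implicit Arguments.
Unset Strict Implicit.
Unset Printing Implicit Defensive.

Import Order.TTheory GRing.Theory Num.Theory.
Import numFieldNormedType.Exports.

Local Open Scope classical_set_scope.
Local Open Scope complex_scope.
Local Open Scope ring_scope.

(** * Bounded linear maps *)

Section BoundedLinear.
Context {R : realType}.

Lemma linear_comp (U V W : lmodType R[i]) (f : V -> W) (g : U -> V) :
  linear f -> linear g -> linear (fun x => f (g x)).
Proof. by move=> fl gl a x y; rewrite gl fl. Qed.

Lemma nrm_comp (U V W : normedModType R[i]) (f : V -> W) (g : U -> V) (K L : R) :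
  0 <= K -> (forall x, nrm (f x) <= K * nrm x) ->
  (forall x, nrm (g x) <= L * nrm x) ->
  forall x, nrm (f (g x)) <= K * L * nrm x.
Proof.
by move=> K0 fK gL x; apply: le_trans (fK _) _; rewrite -mulrA ler_wpM2l.
Qed.

Lemma closed_ker (X Y : normedModType R[i]) (f : X -> Y) :
  linear f -> (forall x, nrm (f x) <= nrm x) -> closed [set x | f x = 0].
Proof.
move=> fl fM x clx; apply: nrm0_eq0; apply/eqP; rewrite eq_le nrm_ge0 andbT.
apply/ler_addgt0Pr => e e0; rewrite add0r.
have [|y [/= fy]] := clx (ball x e%:C); first by apply: nbhsx_ballx; rewrite ltcR.
rewrite -ball_normE /= nrmE ltcR => xy.
by rewrite -[f x]subr0 -fy -(linB fl) (le_trans (fM _)) // ltW.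
Qed.

(** The norm of a class is the infimum of the norms of its members, and [f] takes
    the same value on all of them. *)
Lemma nrm_quot_lift (A : banachAlgType R) (J : closedIdeal A)
    (E : normedModType R[i]) (f : A -> E) :
  linear f -> (forall x, nrm (f x) <= nrm x) -> (forall x, ci_set J x -> f x = 0) ->
  forall z : quotalg J, nrm (f (qrepr z)) <= nrm z.
Proof.
move=> fl fM fJ z; rewrite -{2}(qreprK z) nrm_qpi.
apply: lb_le_inf => [|_ [j Jj <-]].
  by exists (nrm (qrepr z + 0)), 0 => //; exact: ci0.
by rewrite -[f _]addr0 -(fJ j Jj) -(linD fl).
Qed.

Lemma quot_liftE (A : banachAlgType R) (J : closedIdeal A)
    (E : lmodType R[i]) (f : A -> E) :
  linear f -> (forall x, ci_set J x -> f x = 0) ->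
  forall x, f (qrepr (qpi J x)) = f x.
Proof.
move=> fl fJ x; apply/eqP; rewrite -subr_eq0 -(linB fl); apply/eqP.
by apply: fJ; apply/qpi_eq; rewrite qreprK.
Qed.

Lemma nrm_qpi_le (A : banachAlgType R) (J : closedIdeal A) x :
  nrm (qpi J x) <= nrm x.
Proof.
rewrite nrm_qpi; apply: ge_inf; first by exists 0 => _ [j _ <-]; exact: nrm_ge0.
by exists 0; [exact: ci0|rewrite addr0].
Qed.

Lemma tensZl (X Y : normedModType R[i]) (k : R[i]) (x : X) (y : Y) :
  tens (k *: x) y = k *: tens x y.
Proof.
have l : linear (tens ^~ y : X -> ptensor X Y) by exact: tens_linearl.
exact: (linZ l).
Qed.

Lemma tensZr (X Y : normedModType R[i]) (k : R[i]) (x : X) (y : Y) :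
  tens x (k *: y) = k *: tens x y.
Proof.
have l : linear (tens x : Y -> ptensor X Y) by exact: tens_linearr.
exact: (linZ l).
Qed.

End BoundedLinear.

(** * Canonical maps on the projective tensor square *)

Section CanonicalBounds.
Context {R : realType} {A : banachAlgType R}.

Lemma nrm_omega (u : ptensor A A) : nrm (omega u) <= 1 * nrm u.
Proof.
apply: nrm_tlift => // [b|a|a b]; [exact: bmul_linearl|exact: bmul_linearr|].
by rewrite mul1r nrm_bmul.
Qed.

Lemma nrm_tlact (a : A) u : nrm (tlact a u) <= nrm a * nrm u.
Proof.
apply: nrm_tlift => [c k b b'|b k c c'||b c]; rewrite ?nrm_ge0 //.
- by rewrite bmul_linearr tens_linearl.
- by rewrite tens_linearr.
- by apply: le_trans (nrm_tens _ _) _; rewrite mulrA ler_wpM2r ?nrm_ge0 ?nrm_bmul.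
Qed.

Lemma nrm_tract (a : A) u : nrm (tract u a) <= nrm a * nrm u.
Proof.
rewrite /tract; apply: nrm_tlift => [c k b b'|b k c c'||b c]; rewrite ?nrm_ge0 //.
- by rewrite tens_linearl.
- by rewrite bmul_linearl tens_linearr.
- apply: le_trans (nrm_tens _ _) _.
  by rewrite mulrCA ler_wpM2l ?nrm_ge0 // mulrC nrm_bmul.
Qed.

End CanonicalBounds.

Section TensorMap.
Context {R : realType} {A B : banachAlgType R} (h : A -> B).
Hypothesis h_linear : linear h.
Hypothesis h_contractive : forall a, nrm (h a) <= nrm a.

Definition tmap : ptensor A A -> ptensor B B := tlift (fun a b => tens (h a) (h b)).

Let tl b : linear (fun a => tens (h a) (h b) : ptensor B B).
Proof. by move=> k a a'; rewrite h_linear tens_linearl. Qed.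
Let tr a : linear (fun b => tens (h a) (h b) : ptensor B B).
Proof. by move=> k b b'; rewrite h_linear tens_linearr. Qed.
Let tM a b : nrm (tens (h a) (h b) : ptensor B B) <= 1 * (nrm a * nrm b).
Proof.
by rewrite mul1r (le_trans (nrm_tens _ _)) // ler_pM ?nrm_ge0.
Qed.

Lemma tmap_tens a b : tmap (tens a b) = tens (h a) (h b).
Proof. exact: (tlift_tens tl tr ler01 tM). Qed.
Lemma tmap_linear : linear tmap.
Proof. exact: (tlift_linear tl tr ler01 tM). Qed.
Lemma nrm_tmap u : nrm (tmap u) <= 1 * nrm u.
Proof. exact: (nrm_tlift tl tr ler01 tM). Qed.

Hypothesis hM : forall a b, h (a *b b) = h a *b h b.

Lemma tmap_omega u : omega (tmap u) = h (omega u).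
Proof.
move: u; apply: (tens_ext_linear (M := 1 * 1) (N := 1 * 1)).
- exact: linear_comp omega_linear tmap_linear.
- exact: nrm_comp ler01 nrm_omega nrm_tmap.
- exact: linear_comp h_linear omega_linear.
- by apply: nrm_comp ler01 _ nrm_omega => a; rewrite mul1r.
- by move=> a b; rewrite tmap_tens !omega_tens hM.
Qed.

Lemma tmap_tlact a u : tmap (tlact a u) = tlact (h a) (tmap u).
Proof.
move: u; apply: (tens_ext_linear (M := 1 * nrm a) (N := nrm (h a) * 1)).
- exact: linear_comp tmap_linear (tlact_linear a).
- exact: nrm_comp ler01 nrm_tmap (nrm_tlact a).
- exact: linear_comp (tlact_linear _) tmap_linear.
- exact: nrm_comp (nrm_ge0 _) (nrm_tlact _) nrm_tmap.
- by move=> b c; rewrite tlact_tens !tmap_tens tlact_tens hM.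
Qed.

Lemma tmap_tract a u : tmap (tract u a) = tract (tmap u) (h a).
Proof.
move: u; apply: (tens_ext_linear (M := 1 * nrm a) (N := nrm (h a) * 1)).
- exact: linear_comp tmap_linear (tract_linear a).
- exact: nrm_comp ler01 nrm_tmap (nrm_tract a).
- exact: linear_comp (tract_linear _) tmap_linear.
- exact: nrm_comp (nrm_ge0 _) (nrm_tract _) nrm_tmap.
- by move=> b c; rewrite tract_tens !tmap_tens tract_tens hM.
Qed.

Lemma tmapM u v : tmap (u *b v) = tmap u *b tmap v.
Proof.
move: v; apply: (tens_ext_linear (M := 1 * nrm u) (N := nrm (tmap u) * 1)).
- exact: linear_comp tmap_linear (bmul_linearr u).
- exact: nrm_comp ler01 nrm_tmap (nrm_bmul u).
- exact: linear_comp (bmul_linearr _) tmap_linear.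
- exact: nrm_comp (nrm_ge0 _) (nrm_bmul _) nrm_tmap.
move=> c d; move: u.
pose t : ptensor A A := tens c d.
have nr (C : banachAlgType R) (w x : C) : nrm (x *b w) <= nrm w * nrm x.
  by rewrite mulrC nrm_bmul.
apply: (tens_ext_linear (M := 1 * nrm t) (N := nrm (tmap t) * 1)).
- exact: linear_comp tmap_linear (bmul_linearl _).
- exact: nrm_comp ler01 nrm_tmap (nr _ t).
- exact: linear_comp (bmul_linearl _) tmap_linear.
- exact: nrm_comp (nrm_ge0 _) (nr _ (tmap t)) nrm_tmap.
- by move=> a b; rewrite tensM !tmap_tens tensM !hM.
Qed.

(** Multiplicativity of [tmap] is what makes this kernel a two-sided ideal; being
    closed as well, it contains the closed ideal generated by any set of its
    elements. *)
Lemma closed_ideal_ker_tmap : closed_ideal [set u | tmap u = 0].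
Proof.
split=> /=.
- apply: closed_ker; first exact: tmap_linear.
  by move=> u; rewrite -[leRHS]mul1r nrm_tmap.
- exact: lin0 tmap_linear.
- by move=> k u v hu hv; rewrite tmap_linear hu hv scaler0 addr0.
- by move=> u v hv; rewrite tmapM hv; exact: lin0 (bmul_linearr _).
- by move=> u v hv; rewrite tmapM hv; exact: lin0 (bmul_linearl _).
Qed.

End TensorMap.

(** * Modules with trivial left action *)

Section TrivialLeftAction.
Context {R : realType} {F A : banachAlgType R} (M : banachBimodule F A).
Variable f : F -> R[i]^o.
Hypothesis lactE : forall al a, lact M al a = f al *: a.

Lemma tmlact_trivial al u : tmlact M al u = f al *: u.
Proof.
have -> : tmlact M al u = tlift (fun b c => tens (f al *: b) c) u.
  by rewrite /tmlact; congr tlift; apply/funext => b; rewrite lactE.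
have tl c : linear (fun b : A => tens (f al *: b) c : ptensor A A).
  by move=> k b b'; rewrite scalerDr scalerA mulrC -scalerA tens_linearl.
have tr b : linear (fun c : A => tens (f al *: b) c : ptensor A A).
  by move=> k c c'; rewrite tens_linearr.
pose K := complex.Re `|f al|.
have K0 : 0 <= K by exact: Re_ge0.
have tM b c : nrm (tens (f al *: b) c : ptensor A A) <= K * (nrm b * nrm c).
  by apply: le_trans (nrm_tens _ _) _; rewrite nrmZ mulrA.
move: u; apply: (tens_ext_linear (M := K) (N := K)).
- exact: (tlift_linear tl tr K0 tM).
- exact: (nrm_tlift tl tr K0 tM).
- by move=> k u v; rewrite scalerDr !scalerA mulrC.
- by move=> u; rewrite nrmZ.
move=> b c; rewrite (tlift_tens tl tr K0 tM).
exact: tensZl.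
Qed.

Section LeftIdentityModJ.
Variable e : quotalg (idealJ M).
Hypothesis e_left_id : forall x : quotalg (idealJ M), e *b x = x.
Local Notation pi := (qpi (idealJ M)).

(** Applying the product map to a generator of I shows that a (f(al) b - b.al) is
    in J for every a; taking for a a left identity modulo J cancels the factor. *)
Lemma trivial_right_action_mod al b : pi (ract M b al) = f al *: pi b.
Proof.
have [e' eE] := qpiP e.
have gen : ci_set (idealJ M) (omega (tens (lact M al e') b - tens e' (ract M b al))).
  move=> J _; apply; exists (tens (lact M al e') b - tens e' (ract M b al)) => //.
  by move=> I _; apply; exists al, e', b.
move: gen; rewrite (linB omega_linear) !omega_tens => /qpi_eq.
by rewrite lactE bmulZl (linZ (@qpi_linear _ _ _)) !qpiM -eE !e_left_id.
Qed.

(** On a generator, the left action contributes f(al) on the first leg of the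
    tensor and the right action contributes f(al) on the second one, so that the
    two terms have the same image. *)
Lemma tmap_idealI u : ci_set (idealI M) u -> tmap pi u = 0.
Proof.
have cl := closed_ideal_ker_tmap (@qpi_linear _ _ (idealJ M)) (@nrm_qpi_le _ _ _)
  (@qpiM _ _ _).
move=> Iu; apply: (Iu _ cl) => _ [al [a [b ->]]] /=.
rewrite (linB (tmap_linear (@qpi_linear _ _ _) (@nrm_qpi_le _ _ _))).
rewrite !(tmap_tens (@qpi_linear _ _ _) (@nrm_qpi_le _ _ _)).
rewrite lactE trivial_right_action_mod (linZ (@qpi_linear _ _ _)).
by rewrite tensZl tensZr subrr.
Qed.

End LeftIdentityModJ.

(** A nonzero linear functional is surjective.  If f = 0 then every al_j acts by
    zero, while al_j.a converges to a. *)
Lemma trivial_action_surj_or_zero :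
  linear f -> has_bounded_approximate_identity M ->
  (forall k : R[i], exists al, f al = k) \/ (forall a : A, a = 0).
Proof.
move=> fl [D [le [al [[_ le_refl _ _] _ bai]]]].
have [[be fbe]|f0] := pselect (exists be, f be != 0).
  by left=> k; exists ((k / f be) *: be); rewrite (linZ fl); exact: divfK.
right=> a; apply/eqP; apply: contraT => a0.
have [/(_ `|a|)] := bai a; rewrite normr_gt0 => /(_ a0) [j0 /(_ j0 (le_refl _))].
rewrite lactE (_ : f (al j0) = 0) ?scale0r ?sub0r ?normrN ?ltxx //.
by apply/eqP; apply: contraT => fn0; case: f0; exists (al j0).
Qed.

End TrivialLeftAction.

(** * The right inverse *)

(* A and F are the Banach algebras, M the F-bimodule structure of A. *)
Theorem proposition2p6 (R : realType) (F A : banachAlgType R)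
    (M : banachBimodule F A)
    (compatM : compatible_actions M)
    (trivM : trivial_left_action M)
    (left_idJ : exists e : quotalg (idealJ M),
        forall x : quotalg (idealJ M), e *b x = x)
    (baiM : has_bounded_approximate_identity M) :
  module_biprojective M -> biprojective (quotalg (idealJ M)).
Proof.
move=> [rho [[K rhoK] rho_omega rhoP]].
have [f [fl _ lactE]] := trivM; have [e e_id] := left_idJ.
pose pi := qpi (idealJ M); pose tpi := tmap pi.
have pil : linear pi := @qpi_linear _ _ _.
have pin : forall a, nrm (pi a) <= nrm a := @nrm_qpi_le _ _ _.
have piM : forall a b, pi (a *b b) = pi a *b pi b := @qpiM _ _ _.
have tpil : linear tpi := tmap_linear pil pin.
have tpin u : nrm (tpi u) <= nrm u by rewrite -[leRHS]mul1r; exact: nrm_tmap.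
have tpi0 u : ci_set (idealI M) u -> tpi u = 0.
  exact: (tmap_idealI lactE e_id).
pose Phi (z : quotalg (idealI M)) := tpi (qrepr z).
have PhiE u : Phi (qpi _ u) = tpi u by exact: quot_liftE.
have PhiD z w : Phi (z + w) = Phi z + Phi w.
  have [u ->] := qpiP z; have [v ->] := qpiP w.
  by rewrite -(linD (@qpi_linear _ _ _)) !PhiE (linD tpil).
have PhiZ k z : Phi (k *: z) = k *: Phi z.
  by have [u ->] := qpiP z; rewrite -(linZ (@qpi_linear _ _ _)) !PhiE (linZ tpil).
have rho0 : rho 0 = 0 by apply: (addrI (rho 0)); rewrite -(mm_additive rhoP) !addr0.
(* Multiplication by k is the action of some al with f(al) = k. *)
have rhoZ k x : rho (k *: x) = k *: rho x.
  have [fsurj|A0] := trivial_action_surj_or_zero lactE fl baiM; last first.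
    have -> : x = 0 by have [a ->] := qpiP x; rewrite (A0 a); exact: lin0 pil.
    by rewrite scaler0 rho0 scaler0.
  have [al <-] := fsurj k; have := mm_lact rhoP al x.
  rewrite /induced lactE (linZ (@qpi_linear _ _ _)) qreprK => ->.
  by rewrite (tmlact_trivial lactE) (linZ (@qpi_linear _ _ _)) qreprK.
exists (fun x => Phi (rho x)); split.
- by move=> k x y; rewrite (mm_additive rhoP) rhoZ PhiD PhiZ.
- exists K => x; apply: le_trans (rhoK x); rewrite !nrmE lecR.
  exact: nrm_quot_lift.
- move=> x; rewrite /Phi (tmap_omega pil pin piM).
  by rewrite -[RHS]rho_omega /omega_tilde.
(* The value of an induced action on the quotient by I is computed from a
   representative of the class; [Phi] does not see which one is chosen. *)
- move=> x y; have [a ->] := qpiP x.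
  have -> : qpi _ a *b y = induced (bmul a) y by rewrite /induced qpiM qreprK.
  by rewrite (mm_mull rhoP) [LHS]PhiE /tpi (tmap_tlact pil pin piM).
- move=> x y; have [a ->] := qpiP x.
  have -> : y *b qpi _ a = induced (bmul ^~ a) y by rewrite /induced qpiM qreprK.
  by rewrite (mm_mulr rhoP) [LHS]PhiE /tpi (tmap_tract pil pin piM).
Qed.
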